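(* Let $K$ be a non-Archimedean local field, $n\ge1$, $\alpha>0$, $\varphi\in\mathcal D(K^n)$, and let $\check\varphi$ be the Radon transform of $\varphi$. For $t\in K$ and $x,u\in K^n$ with $\|u\|=1$ put $$\Gamma(t,x,u)=\check\varphi(u,t+u\cdot x),$$ and define $$F_1(t,x)=(1-q^{-1})^{-1}\int_{\|u\|=1}\left(D_t^{n-1}\Gamma\right)(t,x,u)\,d^nu,\qquad F_2(t,x)=(1-q^{-1})^{-1}\int_{\|u\|=1}\Gamma(t,x,u)\,d^nu .$$ Then the functions $F_1$ and $F_2$ are radial in $t$ (that is, $F_j(\omega t,x)=F_j(t,x)$ whenever $\omega\in K$, $|\omega|=1$), jointly locally constant in $(t,x)$, and bounded. Both satisfy the equation $$D_t^\alpha F-D_x^{\alpha,n}F=0\quad\text{on } K\times K^n;$$ $F_1$ satisfies the initial condition $F_1(0,x)=\varphi(x)$ for all $x\in K^n$, and $F_2$ satisfies the modified initial condition $\left(D_t^{n-1}F_2\right)(0,x)=\varphi(x)$ for all $x\in K^n$.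
   Context: A non-Archimedean local field $K$ is a non-discrete totally disconnected locally compact topological field; $|\cdot|$ is its normalized absolute value, $q$ is the cardinality of the residue field, so $|\cdot|$ takes the values $q^N$ ($N\in\mathbb Z$) and $0$. Haar measure $dx$ on $K$ is normalized so that $\{x\in K:|x|\le1\}$ has measure $1$; $d^nx=dx_1\cdots dx_n$ on $K^n$; $\|x\|=\max_{1\le j\le n}|x_j|$ and $\xi\cdot x=\xi_1x_1+\cdots+\xi_nx_n$ for $x,\xi\in K^n$. A function $f$ on $K^m$ is called locally constant if there is an integer $l$ such that $f(x+x')=f(x)$ for all $x\in K^m$ and all $x'\in K^m$ with $\|x'\|\le q^{-l}$. $\mathcal D(K^m)$ is the space of complex-valued locally constant functions on $K^m$ with compact support. Operators: for $\alpha>0$ and bounded locally constant $u:K\to\mathbb C$, $$(D^\alpha u)(x)=\frac{1-q^\alpha}{1-q^{-\alpha-1}}\int_K|y|^{-\alpha-1}[u(x-y)-u(x)]\,dy ,$$ and for bounded locally constant $u:K^n\to\mathbb C$, $$(D^{\alpha,n}u)(x)=\frac{1-q^\alpha}{1-q^{-\alpha-n}}\int_{K^n}\|y\|^{-\alpha-n}[u(x-y)-u(x)]\,d^ny .$$ $D^{n-1}$ is $D^\alpha$ with $\alpha=n-1$ when $n\ge2$, and $D^{0}$ is the identity. Subscripts in $D_t^\alpha$, $D_x^{\alpha,n}$ indicate the variable on which the operator acts, the other variables being fixed. Radon transform: let $\chi:K\to\mathbb C^\times$ be a fixed (unitary) additive character of rank zero, i.e. $\chi(x)=1$ for $|x|\le1$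 and $\chi(x_0)\ne1$ for some $x_0$ with $|x_0|=q$. For $\varphi\in\mathcal D(K^n)$ let $\widetilde\varphi(\xi)=\int_{K^n}\chi(x\cdot\xi)\varphi(x)\,d^nx$. For $n\ge2$, $\xi\in K^n\setminus\{0\}$, $s\in K$, the Radon transform is $\check\varphi(\xi,s)=\int_{\xi\cdot x=s}\varphi(x)\,d\omega_{\xi,s}(x)$, where $\omega_{\xi,s}$ is the measure on the hyperplane $\xi\cdot x=s$ such that $\int_K ds\int_{\xi\cdot x=s}\psi(x)\,d\omega_{\xi,s}(x)=\int_{K^n}\psi(x)\,d^nx$ for all $\psi\in\mathcal D(K^n)$; equivalently, $$\check\varphi(\xi,r)=\int_K\chi(-sr)\widetilde\varphi(s\xi)\,ds .$$ For $n=1$ the Radon transform is defined by this last formula. *)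

(* Defs.v *)
From HB Require Import structures.
From mathcomp Require Import all_boot all_order all_algebra.
From mathcomp Require Import complex.
From mathcomp Require Import all_classical all_reals all_analysis.
Set Implicit Arguments.
Unset Strict Implicit.
Unset Printing Implicit Defensive.
Import Order.TTheory GRing.Theory Num.Theory.
Import numFieldNormedType.Exports.
Local Open Scope classical_set_scope.
Local Open Scope ring_scope.
Local Open Scope complex_scope.

HB.mixin Record TopologicalZmodule_isTopologicalField K
    & GRing.Field K & Topological K := {
  topfield_mul_continuous : continuous (fun x : K * K => x.1 * x.2) ;
  topfield_inv_continuous : forall x : K, x != 0 -> {for x, continuous (@GRing.inv K)}
}.

#[short(type="topologicalFieldType")]
HB.structure Definition TopologicalField :=
  {K of TopologicalZmodule K & GRing.Field K
      & TopologicalZmodule_isTopologicalField K}.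

(* The library builds generated sigma-algebras on pointed types only. *)
#[non_forgetful_inheritance]
HB.instance Definition _ (K : topologicalFieldType) := isPointed.Build K 0.

Definition nonarch_local_field (K : topologicalFieldType) : Prop :=
  [/\ ~ (forall A : set K, open A),
      totally_disconnected [set: K] &
      locally_compact [set: K]].

Notation borelType T := (g_sigma_algebraType (@open T)).

Section LocalField.
Context {R : realType} {K : topologicalFieldType}.
Implicit Types (abs : K -> R) (q n : nat) (mu : {measure set (borelType K) -> \bar R}).

Definition residue_field abs : set (set K) :=
  [set [set y | abs (y - x) < 1] | x in [set x | abs x <= 1]].

Record normalized_absval abs q : Prop := NormalizedAbsval {
  absval_ge0 : forall x, 0 <= abs x;
  absval_eq0 : forall x, abs x = 0 <-> x = 0;
  absvalM : forall x y, abs (x * y) = abs x * abs y;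
  absval_ultra : forall x y, abs (x + y) <= Num.max (abs x) (abs y);
  absval_nbhs : forall (x : K) (A : set K),
    nbhs x A <-> exists2 r : R, 0 < r & [set y | abs (y - x) < r] `<=` A;
  absval_residue : (residue_field abs #= `I_q)%card;
  absval_values : [set abs x | x in [set x | x != 0]] =
                  [set q%:R ^ N | N in [set: int]] }.

Definition normn abs n (x : 'rV[K]_n) : R := \big[Num.max/0]_(j < n) abs (x 0 j).

Definition dot n (xi x : 'rV[K]_n) : K := \sum_(j < n) xi 0 j * x 0 j.

(* Finiteness on compact sets, positivity on nonempty open sets and regularity
   are consequences for a local field. *)
Definition normalized_haar abs mu : Prop :=
  (forall (a : K) (A : set (borelType K)), measurable A ->
     mu [set a + x | x in A] = mu A) /\
  mu [set x | abs x <= 1] = 1%:E.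

Definition product_haar mu n
    (mun : {measure set (borelType 'rV[K]_n) -> \bar R}) : Prop :=
  forall A : 'I_n -> set (borelType K), (forall j, measurable (A j)) ->
    mun [set x | forall j, A j (x 0 j)] = (\prod_(j < n) mu (A j))%E.

Definition cintegral d (T : measurableType d) (m : {measure set T -> \bar R})
    (D : set T) (f : T -> R[i]) : R[i] :=
  Complex (Rintegral m D (fun x => complex.Re (f x)))
          (Rintegral m D (fun x => complex.Im (f x))).

Definition locally_constant q (V : zmodType) (nrm : V -> R) (f : V -> R[i]) : Prop :=
  exists l : int, forall x x' : V, nrm x' <= q%:R ^ (- l) -> f (x + x') = f x.

Definition bounded_cfun (V : Type) (f : V -> R[i]) : Prop :=
  exists M : R, forall x, `|f x| <= M%:C.

Definition test_function abs q n (f : 'rV[K]_n -> R[i]) : Prop :=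
  locally_constant q (@normn abs n) f /\ compact (closure [set x | f x != 0]).

(* At y = 0 the library gives 0 `^ r = 0 for r != 0 instead of +oo; the other
   factor vanishes there. *)
Definition Dalpha abs q mu (alpha : R) (u : K -> R[i]) (x : K) : R[i] :=
  ((1 - q%:R `^ alpha) / (1 - q%:R `^ (- alpha - 1)))%:C *
  cintegral mu setT (fun y => (abs y `^ (- alpha - 1))%:C * (u (x - y) - u x)).

Definition Dalphan abs q n (mun : {measure set (borelType 'rV[K]_n) -> \bar R})
    (alpha : R) (u : 'rV[K]_n -> R[i]) (x : 'rV[K]_n) : R[i] :=
  ((1 - q%:R `^ alpha) / (1 - q%:R `^ (- alpha - n%:R)))%:C *
  cintegral mun setT
    (fun y => (normn abs y `^ (- alpha - n%:R))%:C * (u (x - y) - u x)).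

Definition Dnat abs q mu (m : nat) (u : K -> R[i]) : K -> R[i] :=
  if m is 0%N then u else Dalpha abs q mu m%:R u.

(* Continuity follows, chi being trivial on a neighbourhood of 0. *)
Definition rank0_character abs q (chi : K -> R[i]) : Prop :=
  [/\ forall x y, chi (x + y) = chi x * chi y,
      forall x, `|chi x| = 1,
      forall x, abs x <= 1 -> chi x = 1 &
      exists2 x0, abs x0 = q%:R & chi x0 != 1].

Definition fourier n (mun : {measure set (borelType 'rV[K]_n) -> \bar R})
    (chi : K -> R[i]) (phi : 'rV[K]_n -> R[i]) (xi : 'rV[K]_n) : R[i] :=
  cintegral mun setT (fun x => chi (dot x xi) * phi x).

Definition hyperplane n (xi : 'rV[K]_n) (s : K) : set 'rV[K]_n :=
  [set x | dot xi x = s].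

(* The disintegration identity alone determines omega xi s only for almost
   every s; continuity in s selects the usual version, for every s. Only the
   restriction of omega xi s to the hyperplane is relevant. *)
Definition hyperplane_measures abs q mu n
    (mun : {measure set (borelType 'rV[K]_n) -> \bar R})
    (omega : 'rV[K]_n -> K -> {measure set (borelType 'rV[K]_n) -> \bar R}) : Prop :=
  forall xi : 'rV[K]_n, xi != 0 ->
    (forall (s : K) (A : set 'rV[K]_n), compact A -> A `<=` hyperplane xi s ->
       (omega xi s A < +oo)%E) /\
    (forall psi : 'rV[K]_n -> R[i], test_function abs q psi ->
       continuous (fun s => cintegral (omega xi s) (hyperplane xi s) psi : R[i]^o) /\
       cintegral mu setT (fun s => cintegral (omega xi s) (hyperplane xi s) psi) =
       cintegral mun setT psi).

Definition radon mu n (mun : {measure set (borelType 'rV[K]_n) -> \bar R})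
    (chi : K -> R[i])
    (omega : 'rV[K]_n -> K -> {measure set (borelType 'rV[K]_n) -> \bar R})
    (phi : 'rV[K]_n -> R[i]) (xi : 'rV[K]_n) (r : K) : R[i] :=
  if n == 1%N then
    cintegral mu setT (fun s => chi (- (s * r)) * fourier mun chi phi (s *: xi))
  else cintegral (omega xi r) (hyperplane xi r) phi.

Definition radial_in_t abs n (F : K -> 'rV[K]_n -> R[i]) : Prop :=
  forall w t x, abs w = 1 -> F (w * t) x = F t x.

Definition norm_tx abs n (p : K * 'rV[K]_n) : R :=
  Num.max (abs p.1) (normn abs p.2).

Definition wave_equation abs q mu n
    (mun : {measure set (borelType 'rV[K]_n) -> \bar R}) (alpha : R)
    (F : K -> 'rV[K]_n -> R[i]) : Prop :=
  forall t x, Dalpha abs q mu alpha (fun t' => F t' x) t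
            - Dalphan abs q mun alpha (fun x' => F t x') x = 0.

End LocalField.

(* Main.v *)
Require Import Defs.
From HB Require Import structures.
From mathcomp Require Import all_boot all_order all_algebra.
From mathcomp Require Import complex.
From mathcomp Require Import all_classical all_reals all_analysis.
From mathcomp Require Import measurable_realfun ring zify.
Set Implicit Arguments.
Unset Strict Implicit.
Unset Printing Implicit Defensive.
Import Order.TTheory GRing.Theory Num.Theory.
Import numFieldNormedType.Exports.
Local Open Scope classical_set_scope.
Local Open Scope ring_scope.
Local Open Scope complex_scope.

(** Both F1 and F2 are superpositions, over the directions u of the unit sphere,
    of plane waves H u (t + u.x), and for such functions everything reduces to
    finite sums and to the averages of a function over balls.

    The Radon transform.  A test function phi is a finite sum of the functions
    phi(a) 1_{|x - a| <= q^k}.  For |u| = 1, hyperplane_radon (from the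
    disintegration of Haar measure, n >= 2) and fourier_radon (from the
    orthogonality of characters, for n = 1) give the Radon transform of phi as
    sum_a phi(a) q^{k(n-1)} e(r - u.a), where e is the indicator of |r| <= q^k.
    So F2 is the superposition with profile e, and F1 the one with profile
    E = D^{n-1} e (family, family_Dnat).

    The operators.  Let A_N f be the average of f over balls of radius q^N.
    Summation by parts over the spheres |y| = q^N turns the integral defining
    the operator, in any dimension, into
      D^alpha f = sum_N q^{-alpha N} (A_N f - A_{N+1} f)      (spectral_cvg);
    A_N - A_{N+1} is the projection onto the frequencies of absolute value
    q^{-N}, which D^alpha multiplies by q^{-alpha N}.  The dimension has
    disappeared, so operators on K and on K^n can be compared through averages
    alone (vladimirov_eq).

    The equation.  For |u| = 1 a linear isometry of K^n turns u.y into a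
    coordinate, hence y |-> g(u.y) and s |-> g(s) have equal averages over the
    balls of radius q^N (plane_integral).  Averaging F over a ball in x is
    therefore the same as averaging it over a ball in t (superpose_mean), and
    the equation follows (superpose_wave).

    The initial condition.  By the spectral form of D^{n-1}, the integral of
    E(u.z) over the sphere is a sum over N of differences of the volumes of
    {|u| = 1, |u.z| <= q^N}.  The weight q^{-(n-1)N} is the radial density of
    polar coordinates in frequency space: it turns each term into the
    corresponding difference of normalized indicators of the balls of K^n
    (polar), so that the sum telescopes to a multiple of the indicator of
    |z| <= q^k (sphere_source), and summation over a recovers phi.

    Fubini and changes of variables are needed only for functions constant on
    balls of a fixed radius inside a bounded set.  There an integral is a finite
    sum over a net, a set of representatives of these balls (net_integral). *)

(** * Integrals of complex-valued functions *)

Section ComplexIntegral.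
Context {R : realType} {d} {T : measurableType d} (m : {measure set T -> \bar R}).
Implicit Types (f g : T -> R[i]) (D : set T).

Definition cintegrable D f : Prop :=
  m.-integrable D (fun x => (complex.Re (f x))%:E) /\
  m.-integrable D (fun x => (complex.Im (f x))%:E).

Lemma complex_eqP (z w : R[i]) :
  complex.Re z = complex.Re w -> complex.Im z = complex.Im w -> z = w.
Proof. by case: z w => a b [a' b'] /= -> ->. Qed.

Lemma cReM (z w : R[i]) : complex.Re (z * w) =
  complex.Re z * complex.Re w - complex.Im z * complex.Im w.
Proof. by case: z w => a b [a' b']. Qed.

Lemma cImM (z w : R[i]) : complex.Im (z * w) =
  complex.Re z * complex.Im w + complex.Im z * complex.Re w.
Proof. by case: z w => a b [a' b']. Qed.

Lemma eq_cintegral D f g : (forall x, D x -> f x = g x) ->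
  cintegral m D f = cintegral m D g.
Proof.
move=> fg; rewrite /cintegral; congr Complex;
  by apply: eq_Rintegral => x; rewrite inE => /fg ->.
Qed.

Lemma cintegralD D f g : measurable D -> cintegrable D f -> cintegrable D g ->
  cintegral m D (fun x => f x + g x) = cintegral m D f + cintegral m D g.
Proof.
move=> mD [rf imf] [rg img]; apply: complex_eqP; rewrite raddfD /=.
  rewrite -RintegralD//; apply: eq_Rintegral => x _; exact: raddfD.
rewrite -RintegralD//; apply: eq_Rintegral => x _; exact: raddfD.
Qed.

Lemma cintegrableD D f g : measurable D -> cintegrable D f -> cintegrable D g ->
  cintegrable D (fun x => f x + g x).
Proof.
move=> mD [rf imf] [rg img]; split.
  apply: eq_integrable (integrableD mD rf rg) => // x _ /=.
  by rewrite -EFinD -raddfD.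
apply: eq_integrable (integrableD mD imf img) => // x _ /=.
by rewrite -EFinD -raddfD.
Qed.

Lemma cintegrableZ D c f : measurable D -> cintegrable D f ->
  cintegrable D (fun x => c * f x).
Proof.
move=> mD [rf imf]; split.
  have h1 := integrableZl mD (complex.Re c) rf.
  have h2 := integrableZl mD (- complex.Im c) imf.
  apply: eq_integrable (integrableD mD h1 h2) => // x _ /=.
  by rewrite -!EFinM -EFinD cReM mulNr.
have h1 := integrableZl mD (complex.Re c) imf.
have h2 := integrableZl mD (complex.Im c) rf.
apply: eq_integrable (integrableD mD h1 h2) => // x _ /=.
by rewrite -!EFinM -EFinD cImM.
Qed.

Lemma cintegralZ D c f : measurable D -> cintegrable D f ->
  cintegral m D (fun x => c * f x) = c * cintegral m D f.
Proof.
move=> mD [rf imf].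
have h (k : R) u : m.-integrable D (fun x => (u x)%:E) ->
    m.-integrable D (EFin \o (fun x => k * u x)).
  by move=> iu; apply: eq_integrable (integrableZl mD k iu).
apply: complex_eqP; rewrite ?cReM ?cImM /=.
  rewrite -!RintegralZl// -RintegralB//; [|exact: h|exact: h].
  by apply: eq_Rintegral => x _; rewrite cReM.
rewrite -!RintegralZl// -RintegralD//; [|exact: h|exact: h].
by apply: eq_Rintegral => x _; rewrite cImM.
Qed.

Lemma cintegralB D f g : measurable D -> cintegrable D f -> cintegrable D g ->
  cintegral m D (fun x => f x - g x) = cintegral m D f - cintegral m D g.
Proof.
move=> mD [rf imf] [rg img]; apply: complex_eqP; rewrite raddfB /=.
  rewrite -RintegralB//; apply: eq_Rintegral => x _; exact: raddfB.
rewrite -RintegralB//; apply: eq_Rintegral => x _; exact: raddfB.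
Qed.

Lemma cintegral0 D : cintegral m D (fun=> 0) = 0.
Proof. by apply: complex_eqP => /=; rewrite /Rintegral integral0. Qed.

Lemma cintegrable0 D : cintegrable D (fun=> 0).
Proof. by split; exact: integrable0. Qed.

Lemma cintegral_sum (I : Type) (s : seq I) (f : I -> T -> R[i]) D :
  measurable D -> (forall i, cintegrable D (f i)) ->
  cintegrable D (fun x => \sum_(i <- s) f i x) /\
  cintegral m D (fun x => \sum_(i <- s) f i x) =
  \sum_(i <- s) cintegral m D (f i).
Proof.
move=> mD fi; elim: s => [|i s [IHi IH]].
  have E : (fun x => \sum_(i <- [::]) f i x) = fun=> 0.
    by apply/funext => x; rewrite big_nil.
  by rewrite E big_nil cintegral0; split => //; exact: cintegrable0.
have -> : (fun x => \sum_(i <- i :: s) f i x) =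
          fun x => f i x + \sum_(i <- s) f i x.
  by apply/funext => x; rewrite big_cons.
rewrite big_cons cintegralD// IH; split => //; exact: cintegrableD.
Qed.

(** Integrability is part of the conclusion because the union has finite
    measure and f takes finitely many values on it. *)
Lemma Rintegral_pieces (I : eqType) (s : seq I) (A : I -> set T) (c : I -> R)
    (f : T -> R) :
  (forall i, measurable (A i)) -> (forall i, i \in s -> (m (A i) < +oo)%E) ->
  uniq s -> trivIset [set` s] A ->
  (forall i x, i \in s -> A i x -> f x = c i) ->
  m.-integrable (\big[setU/set0]_(i <- s) A i) (fun x => (f x)%:E) /\
  Rintegral m (\big[setU/set0]_(i <- s) A i) f =
    \sum_(i <- s) c i * fine (m (A i)).
Proof.
move=> mA fA us tA fc.
have mf : measurable_fun (\big[setU/set0]_(i <- s) A i) f.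
  elim: s us fc {fA tA} => [|i s IH] /=.
    by rewrite big_nil => _ _; exact: measurable_fun_set0.
  move=> /andP[_ us] fc; rewrite big_cons; apply/measurable_funU => //.
    exact: bigsetU_measurable.
  split; last by apply: IH => // j x js; apply: fc; rewrite inE js orbT.
  apply: (eq_measurable_fun (fun=> c i)); last exact: measurable_cst.
  by move=> x; rewrite inE => Ax; rewrite (fc i)// mem_head.
have iA i : i \in s ->
    (\int[m]_(x in A i) (f x)%:E = (c i * fine (m (A i)))%:E)%E.
  move=> si; rewrite (@eq_integral _ _ _ _ _ (fun=> (c i)%:E)); last first.
    by move=> x; rewrite inE => Ax; rewrite (fc i).
  by rewrite integral_cst// EFinM fineK// ge0_fin_numE// fA.
split.
  apply: measurable_bounded_integrable => //.
  - exact: bigsetU_measurable.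
  - elim: s us fA {tA fc mf iA} => [|i s IH] /=.
      by rewrite big_nil measure0.
    move=> /andP[_ us] fA; rewrite big_cons.
    have mU : measurable (\big[setU/set0]_(j <- s) A j).
      exact: bigsetU_measurable.
    apply: (le_lt_trans (measureU2 m (mA i) mU)).
    rewrite lte_add_pinfty ?fA ?mem_head//; apply: IH => // j js.
    by apply: fA; rewrite inE js orbT.
  - exists (\sum_(i <- s) `|c i|); split; first exact: num_real.
    move=> M cM x Dx.
    have [i si Ax] : exists2 i, i \in s & A i x.
      move: Dx {cM us mf fA tA fc iA}; elim: s => [|i s IH].
        by rewrite big_nil.
      rewrite big_cons => -[Ax|/IH[j js Aj]]; first by exists i; rewrite ?mem_head.
      by exists j => //; rewrite inE js orbT.
    rewrite /= (fc i)//; apply: le_trans (ltW cM).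
    rewrite (perm_big _ (perm_to_rem si)) big_cons lerDl.
    by apply: sumr_ge0.
rewrite /Rintegral integral_bigsetU_EFin//; last exact/measurable_EFinP.
rewrite big_seq (eq_bigr (fun i => (c i * fine (m (A i)))%:E)); last by move=> i; exact: iA.
by rewrite -big_seq sumEFin.
Qed.

(** Integrals over bounded domains are evaluated through this lemma: the
    integrands are locally constant, hence simple functions. *)
Lemma cintegral_pieces (I : choiceType) (s : seq I) (A : I -> set T) (c : I -> R[i])
    (D : set T) (f : T -> R[i]) :
  (forall i, measurable (A i)) -> (forall i, i \in s -> (m (A i) < +oo)%E) ->
  uniq s -> trivIset [set` s] A ->
  (forall x, D x <-> exists2 i, i \in s & A i x) ->
  (forall i x, i \in s -> A i x -> f x = c i) ->
  cintegrable D f /\ cintegral m D f = \sum_(i <- s) c i * (fine (m (A i)))%:C.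
Proof.
move=> mA fA us tA DE fc.
have -> : D = \big[setU/set0]_(i <- s) A i.
  rewrite -bigcup_seq; apply/seteqP; split => x.
    by move=> /DE[i si Ax]; exists i.
  by move=> [i si Ax]; apply/DE; exists i.
have [r1 r2] := @Rintegral_pieces I s A (fun i => complex.Re (c i))
  (fun x => complex.Re (f x)) mA fA us tA
  (fun i x si Ax => congr1 (@complex.Re R) (fc i x si Ax)).
have [i1 i2] := @Rintegral_pieces I s A (fun i => complex.Im (c i))
  (fun x => complex.Im (f x)) mA fA us tA
  (fun i x si Ax => congr1 (@complex.Im R) (fc i x si Ax)).
split; first by split.
apply: complex_eqP; rewrite raddf_sum /= ?r2 ?i2; apply: eq_bigr => i _.
  by rewrite cReM /= mulr0 subr0.
by rewrite cImM /= mulr0 add0r.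
Qed.

End ComplexIntegral.

Section Restriction.
Context {R : realType} {d} {T : measurableType d} (m : {measure set T -> \bar R}).

Lemma cintegral_if (D : set T) (b : T -> bool) (f : T -> R[i]) :
  cintegral m D (fun x => if b x then f x else 0) =
  cintegral m (D `&` [set x | b x]) f.
Proof.
apply: complex_eqP => /=; rewrite Rintegral_mkcondr; apply: eq_Rintegral => x _;
  rewrite patchE; case: ifP => bx.
- by rewrite mem_set.
- by rewrite memNset//= bx.
- by rewrite mem_set.
- by rewrite memNset//= bx.
Qed.

End Restriction.

(** * Locally constant functions on ultrametric measure spaces *)

Section UltrametricDef.
Context {R : realType} {d0} {T : measurableType d0}.
Variables (dist : T -> T -> R) (q : nat).

Definition cball (a : T) (k : int) : set T := [set x | dist a x <= q%:R ^ k].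

(** Local constancy at scale q^k near D.  The second point is not asked to lie
    in D: on a saturated set it does so automatically. *)
Definition flat (U : Type) (k : int) (D : set T) (f : T -> U) : Prop :=
  forall x y, D x -> dist x y <= q%:R ^ k -> f x = f y.

Definition saturated (k : int) (D : set T) : Prop :=
  forall x y, D x -> dist x y <= q%:R ^ k -> D y.

(** A system of representatives of the balls of radius q^k that make up D. *)
Definition net (k : int) (D : set T) (s : seq T) : Prop :=
  [/\ uniq s, forall a, a \in s -> D a,
      forall a b, a \in s -> b \in s -> dist a b <= q%:R ^ k -> a = b &
      forall x, D x -> exists2 a, a \in s & dist a x <= q%:R ^ k].

(** What K (d = 1) and K^n (d = n) have in common.  Only a distance is recorded,
    no algebra: translations, multiplications by units and the linear changes of
    coordinates below act as isometries. *)
Record ultra_space (m : {measure set T -> \bar R}) (d : nat) : Prop := UltraSpace {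
  us_q : (1 < q)%N;
  us_xx : forall x, dist x x = 0;
  us_sym : forall x y, dist x y = dist y x;
  us_ultra : forall x y z, dist x z <= Num.max (dist x y) (dist y z);
  us_val : forall x y, dist x y = 0 \/ exists k : int, dist x y = q%:R ^ k;
  us_meas : forall a k, measurable (cball a k);
  us_vol : forall a k, m (cball a k) = ((q%:R ^+ d) ^ k)%:E }.

End UltrametricDef.

Section UltraSpace.
Context {R : realType} {d0} {T : measurableType d0}.
Variables (dist : T -> T -> R) (q : nat) (m : {measure set T -> \bar R}) (d : nat).
Hypothesis us : ultra_space dist q m d.
Local Notation Q := (q%:R : R).
Local Notation V := (Q ^+ d).
Local Notation cball := (cball dist q).
Local Notation flat := (flat dist q).
Local Notation saturated := (saturated dist q).
Local Notation net := (net dist q).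

Lemma Q_gt1 : 1 < Q. Proof. by rewrite ltr1n (us_q us). Qed.
Lemma Q_gt0 : 0 < Q. Proof. exact: lt_trans ltr01 Q_gt1. Qed.
Lemma Qz_gt0 k : 0 < Q ^ k. Proof. exact: exprz_gt0 Q_gt0. Qed.
Lemma V_gt0 : 0 < V. Proof. exact: exprn_gt0 Q_gt0. Qed.
Lemma Vz_gt0 k : 0 < V ^ k. Proof. exact: exprz_gt0 V_gt0. Qed.

Lemma Q_le k l : (Q ^ k <= Q ^ l) = (k <= l).
Proof. exact: ler_eXz2l Q_gt1 k l. Qed.

Lemma dist_trans x y z r : dist x y <= r -> dist y z <= r -> dist x z <= r.
Proof. by move=> xy yz; apply: le_trans (us_ultra us x y z) _; rewrite ge_max xy. Qed.

Lemma dist_xx_le x k : dist x x <= Q ^ k.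
Proof. by rewrite (us_xx us) ltW// Qz_gt0. Qed.

Lemma dist_shell x y k : ~ dist x y <= Q ^ k -> dist x y <= Q ^ (k + 1) ->
  dist x y = Q ^ (k + 1).
Proof.
case: (us_val us x y) => [->|[j ->]]; first by case; exact/ltW/Qz_gt0.
move=> /negP; rewrite !Q_le => h1 h2; congr (_ ^ _); lia.
Qed.

(** In an ultrametric triangle the two longest sides are equal. *)
Lemma dist_far x y z k : dist x y <= Q ^ k -> ~ dist z x <= Q ^ k ->
  dist z x = dist z y.
Proof.
move=> xy /negP; rewrite -ltNge => zx; apply/eqP; rewrite eq_le.
have lt_xy : dist x y < dist z x by exact: le_lt_trans zx.
apply/andP; split.
  have := us_ultra us z y x; rewrite (us_sym us y x) le_max => /orP[//|h].
  by have := le_lt_trans h lt_xy; rewrite ltxx.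
have := us_ultra us z x y; rewrite le_max => /orP[//|h].
exact: le_trans h (ltW lt_xy).
Qed.

Lemma dist_bounded o x : exists n : nat, dist o x <= Q ^ n.
Proof.
case: (us_val us o x) => [->|[k ->]]; first by exists 0%N.
by exists `|k|%N; rewrite Q_le; lia.
Qed.

Lemma cball_saturated o k N : k <= N -> saturated k (cball o N).
Proof.
move=> kN x y /= ox xy; apply: dist_trans ox _.
by apply: le_trans xy _; rewrite Q_le.
Qed.

Lemma saturatedW (k l : int) D : l <= k -> saturated k D -> saturated l D.
Proof. by move=> lk h x y Dx xy; apply: h Dx _ => //; apply: le_trans xy _; rewrite Q_le. Qed.

Lemma cball_disjoint k (s : seq T) : (forall a b, a \in s -> b \in s -> dist a b <= Q ^ k -> a = b) ->
  trivIset [set` s] (cball ^~ k).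
Proof.
move=> sep a b /= sa sb [x [/= ax bx]]; apply: sep => //.
by apply: dist_trans ax _; rewrite (us_sym us).
Qed.

(** The balls around the points of s are disjoint and fill part of a ball of
    finite volume. *)
Lemma separated_size o N k (s : seq T) : k <= N -> uniq s ->
  (forall a, a \in s -> cball o N a) ->
  (forall a b, a \in s -> b \in s -> dist a b <= Q ^ k -> a = b) ->
  (size s)%:R * V ^ k <= V ^ N.
Proof.
move=> kN us_ so sep.
have [i1 i2] := @Rintegral_pieces R d0 T m T s (cball ^~ k) (fun=> 1) (fun=> 1)
  (fun a => us_meas us a k)
  (fun a _ => eq_ind_r (fun e => (e < +oo)%E) (ltry _) (us_vol us a k)) us_
  (cball_disjoint sep) (fun _ _ _ _ => erefl).
set D := \big[setU/set0]_(i <- s) cball i k in i1 i2.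
have mD : measurable D by apply: bigsetU_measurable => i _; exact: (us_meas us).
have sD : D `<=` cball o N.
  rewrite /D -bigcup_seq => x [a /= sa ax]; apply: dist_trans (so a sa) _.
  by apply: le_trans ax _; rewrite Q_le.
have le1 : (m D <= m (cball o N))%E.
  by apply: le_measure => //; apply: mem_set => //; exact: us_meas us o N.
have mo : m (cball o N) = (V ^ N)%:E := us_vol us o N.
have <- : fine (m D) = (size s)%:R * V ^ k.
  have := Rintegral_cst m mD 1; rewrite mul1r => <-; rewrite i2.
  rewrite (eq_bigr (fun=> V ^ k)); last by move=> a _; rewrite mul1r (us_vol us).
  by rewrite big_const_seq count_predT iter_addr_0 mulr_natl.
rewrite -[V ^ N]/(fine (V ^ N)%:E) -mo; apply: fine_le => //; last by rewrite mo.
by rewrite ge0_fin_numE// (le_lt_trans le1)// mo ltry.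
Qed.

(** A maximal separated set is a net; it exists because volume bounds the
    cardinality of separated sets. *)
Lemma net_exists o N k (D : set T) : k <= N -> D `<=` cball o N ->
  exists s, net k D s.
Proof.
move=> kN Do; apply: contrapT => nonet.
suff H n : exists s : seq T, [/\ size s = n, uniq s, forall a, a \in s -> D a &
    forall a b, a \in s -> b \in s -> dist a b <= Q ^ k -> a = b].
  have [n nP] : exists n : nat, V ^ N < n%:R * V ^ k.
    exists (Num.bound (V ^ N / V ^ k)); rewrite -ltr_pdivrMr ?Vz_gt0//.
    by apply: archi_boundP; rewrite divr_ge0// ltW ?Vz_gt0.
  have [s [sn us_ sD sep]] := H n.
  have := separated_size kN us_ (fun a sa => Do a (sD a sa)) sep.
  by rewrite sn leNgt nP.
elim: n => [|n [s [sn us_ sD sep]]]; first by exists [::].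
have [x [Dx nx]] : exists x, D x /\ forall a, a \in s -> ~ dist a x <= Q ^ k.
  apply: contrapT => nox; apply: nonet; exists s; split => // x Dx.
  apply: contrapT => nx; apply: nox; exists x; split => // a sa ax.
  by apply: nx; exists a.
exists (x :: s); split => /=.
- by rewrite sn.
- rewrite us_ andbT; apply/negP => sx; exact: nx sx (dist_xx_le x k).
- by move=> a; rewrite inE => /orP[/eqP ->//|]; exact: sD.
- move=> a b; rewrite !inE => /orP[/eqP ->|sa] /orP[/eqP ->|sb] //.
  + by rewrite (us_sym us) => ax; case: (nx _ sb).
  + by move=> ax; case: (nx _ sa).
  + exact: sep.
Qed.

Lemma net_integral k D s (f : T -> R[i]) :
  net k D s -> saturated k D -> flat k D f ->
  cintegrable m D f /\ cintegral m D f = (V ^ k)%:C * \sum_(a <- s) f a.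
Proof.
move=> [us_ sD sep cov] satD fD.
have [||||||i e] := @cintegral_pieces R d0 T m T s (cball ^~ k) f D f.
- by move=> a; exact: (us_meas us).
- by move=> a _; rewrite (us_vol us) ltry.
- exact: us_.
- exact: cball_disjoint.
- move=> x; split; first by move=> /cov[a sa ax]; exists a.
  by move=> [a /sD Da ax]; exact: satD Da ax.
- by move=> a x /sD Da ax; rewrite (fD a x).
split => //; rewrite e mulr_sumr; apply: eq_bigr => a _.
by rewrite (us_vol us) mulrC.
Qed.

Lemma flat_integrable o N k D (f : T -> R[i]) : k <= N -> D `<=` cball o N ->
  saturated k D -> flat k D f -> cintegrable m D f.
Proof.
move=> kN Do satD fD; have [s sP] := net_exists kN Do.
exact: (net_integral sP satD fD).1.
Qed.

(** An isometry carries nets to nets, so both sides are the same finite sum. *)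
Lemma isometry_integral (phi : T -> T) o N k (D D' : set T) (f : T -> R[i]) :
  k <= N -> D `<=` cball o N -> saturated k D -> saturated k D' -> flat k D' f ->
  (forall x y, dist (phi x) (phi y) = dist x y) ->
  (forall x, D x -> D' (phi x)) ->
  (forall y, D' y -> exists2 x, D x & phi x = y) ->
  cintegral m D (f \o phi) = cintegral m D' f.
Proof.
move=> kN Do satD satD' fD' iso into onto.
have [s sP] := net_exists kN Do; have [us_ sD sep cov] := sP.
have phi_inj : {in s &, injective phi}.
  by move=> a b sa sb ab; apply: sep => //; rewrite -iso ab dist_xx_le.
have nP : net k D' (map phi s).
  split.
  - by rewrite map_inj_in_uniq.
  - by move=> _ /mapP[a sa ->]; apply: into; exact: sD.
  - by move=> _ _ /mapP[a sa ->] /mapP[b sb ->]; rewrite iso => /sep ->.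
  - move=> y /onto[x Dx <-]; have [a sa ax] := cov x Dx.
    by exists (phi a); rewrite ?iso// map_f.
rewrite (net_integral nP satD' fD').2 (net_integral sP satD _).2 ?big_map//.
by move=> x y Dx xy /=; apply: fD'; rewrite ?iso//; exact: into.
Qed.

(** Inside each ball D is a finite union of balls, indexed by a net. *)
Lemma saturated_measurable k D : saturated k D -> measurable D.
Proof.
move=> satD.
have -> : D = \bigcup_(n in setT) (D `&` cball point (n%:Z)).
  apply/seteqP; split => [x Dx|x [n _ []]//].
  by have [n xn] := dist_bounded point x; exists n.
apply: bigcup_measurable => n _.
have [j [jk jn]] : exists j : int, j <= k /\ j <= n%:Z by exists (Num.min k 0); lia.
have [s [us_ sD sep cov]] := net_exists jn (@subIsetr _ D (cball point n)).
have -> : D `&` cball point n = \big[setU/set0]_(a <- s) cball a j.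
  rewrite -bigcup_seq; apply/seteqP; split => x.
    by move=> /cov[a sa ax]; exists a.
  move=> [a /sD[Da oa] ax]; split; first exact: saturatedW jk satD a x Da ax.
  exact: cball_saturated jn a x oa ax.
by apply: bigsetU_measurable => a _; exact: (us_meas us).
Qed.

Lemma flat_measurable k (g : T -> R) : flat k setT g -> measurable_fun setT g.
Proof.
move=> gk _ Y _; rewrite setTI; apply: (@saturated_measurable k).
by move=> x y /= Yx xy; rewrite -(gk x y).
Qed.

End UltraSpace.

(** * The spectral form of the Vladimirov operator *)

Section Spectral.
Context {R : realType} {d0} {T : measurableType d0}.
Variables (dist : T -> T -> R) (q : nat) (m : {measure set T -> \bar R}) (d : nat).
Hypothesis us : ultra_space dist q m d.
Local Notation Q := (q%:R : R).
Local Notation V := (Q ^+ d).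
Local Notation cball := (cball dist q).
Local Notation flat := (flat dist q).
Variables (o : T) (alpha : R).

(** The kernel |y|^{-alpha - d} of the operator in dimension d. *)
Definition weight (y : T) : R := dist o y `^ (- alpha - d%:R).

Definition ravg (N : int) (g : T -> R) : R :=
  V ^ (- N) * Rintegral m (cball o N) g.

Local Notation b := (Q `^ (- alpha)).
Local Notation c := (Q `^ (- alpha - d%:R)).

Let Q0 : 0 < Q := Q_gt0 us.

Lemma decay_gt0 : 0 < b. Proof. exact: powR_gt0. Qed.

Lemma decay_lt1 : 0 < alpha -> b < 1.
Proof.
move=> alpha_gt0.
rewrite powRN invf_lt1 ?powR_gt0//.
have := gt0_ltr_powR alpha_gt0 (x := 1) (y := Q); rewrite powR1; apply.
- by rewrite nnegrE.
- by rewrite nnegrE ltW.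
- exact: Q_gt1 us.
Qed.

Lemma weightE y N : dist o y = Q ^ N -> weight y = c ^ N.
Proof.
move=> e; rewrite /weight e; set gamma := - alpha - d%:R.
rewrite -(powR_intmul N (ltW Q0)) -(powR_intmul N (powR_ge0 Q gamma)) -!powRrM.
by rewrite [N%:~R * _]mulrC.
Qed.

(** From one shell |y| = q^N to the next the kernel is multiplied by c and the
    volume of balls by q^d.  The product b = q^{-alpha} < 1 is what makes the
    integrals converge at infinity. *)
Lemma kernel_decay : c * V = b.
Proof.
rewrite -powR_mulrn ?ltW// -powRD; first by rewrite subrK.
by rewrite (lt0r_neq0 Q0) implybT.
Qed.

Lemma kernel_gt0 : 0 < c. Proof. exact: powR_gt0. Qed.

Lemma kernel_decayz N : c ^ N * V ^ N = b ^ N.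
Proof. by rewrite -expfzMl kernel_decay. Qed.

Variables (k : int) (g : T -> R) (M : R).
Hypothesis g_flat : flat k setT g.
Hypothesis g_le : forall y, `|g y| <= M.
Hypothesis g0 : forall y, cball o k y -> g y = 0.

Let wg y := weight y * g y.

Lemma weight_flat : flat k setT wg.
Proof.
move=> x y _ xy; rewrite /wg.
have [ox|ox] := pselect (cball o k x).
  have oy : cball o k y by exact: (dist_trans us ox xy).
  by rewrite (g0 ox) (g0 oy) !mulr0.
rewrite /weight (dist_far us xy ox); congr (_ * _); exact: g_flat.
Qed.

Lemma ball_integrable N (h : T -> R) : k <= N -> flat k setT h ->
  m.-integrable (cball o N) (fun y => (h y)%:E).
Proof.
move=> kN hf.
have [//||+ _] := @flat_integrable _ _ _ _ _ _ _ us o N k (cball o N)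
   (fun y => (h y)%:C) kN (fun _ => id).
- exact (@cball_saturated _ _ _ _ _ _ _ us o k N kN).
- by move=> x y _ xy; congr (_%:C); exact: hf.
- exact: id.
Qed.

Lemma shell_integral N : k <= N ->
  Rintegral m (cball o (N + 1)) wg =
  Rintegral m (cball o N) wg +
  c ^ (N + 1) * (Rintegral m (cball o (N + 1)) g - Rintegral m (cball o N) g).
Proof.
move=> kN.
have mB j : measurable (cball o j) by exact: us_meas us o j.
set S := cball o (N + 1) `\` cball o N.
have mS : measurable S by exact: measurableD.
have BE : cball o (N + 1) = cball o N `|` S.
  rewrite /S setDE setUIr setUCr setIT; apply/seteqP; split => x; first by right.
  by case=> // /le_trans; apply; rewrite (Q_le us); lia.
have dS : [disjoint cball o N & S] by apply/disj_setPS => x [h1 [_ h2]].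
have kN1 : k <= N + 1 by lia.
have iw := ball_integrable kN1 weight_flat; have ig := ball_integrable kN1 g_flat.
rewrite BE in iw ig *; rewrite !Rintegral_setU//.
rewrite [X in _ + _ * X]addrAC subrr add0r; congr (_ + _).
rewrite -RintegralZl//; last first.
  by apply: integrableS ig => //; exact: measurableU.
apply: eq_Rintegral => x; rewrite inE => -[x1 x2].
by rewrite /wg (weightE (dist_shell us x2 x1)).
Qed.

(** Summation by parts over the shells replaces integrals over shells by
    averages over balls; the last term is the boundary term. *)
Lemma ball_abel P :
  (1 - b^-1) * Rintegral m (cball o (k + P%:Z)) wg =
  (1 - c) * (\sum_(j < P) b ^ (k + j%:Z) * (ravg (k + j%:Z) g - ravg (k + j%:Z + 1) g))
  + (1 - c / b) * b ^ (k + P%:Z) * ravg (k + P%:Z) g.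
Proof.
have b0 := decay_gt0; have bN : b != 0 by rewrite gt_eqF.
have z0 (h : T -> R) : (forall y, cball o k y -> h y = 0) ->
    Rintegral m (cball o k) h = 0.
  move=> h0; rewrite (@eq_Rintegral _ _ _ _ _ (fun=> 0)) ?/Rintegral ?integral0//.
  by move=> y; rewrite inE; exact: h0.
elim: P => [|P IH].
  rewrite addr0 big_ord0 /ravg !z0 ?mulr0 ?addr0//.
  by move=> y ky; rewrite /wg g0 ?mulr0.
rewrite -addn1 PoszD addrA; set N := k + P%:Z in IH *.
have kN : k <= N by rewrite /N; lia.
rewrite (shell_integral kN) mulrDr IH addn1 big_ord_recr /= -/N.
have IE (j : int) : Rintegral m (cball o j) g = V ^ j * ravg j g.
  by rewrite /ravg mulrA -invr_expz divff ?mul1r// gt_eqF ?(Vz_gt0 us).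
rewrite !IE.
have -> : c ^ (N + 1) * (V ^ (N + 1) * ravg (N + 1) g - V ^ N * ravg N g) =
    b ^ N * b * ravg (N + 1) g - c * b ^ N * ravg N g.
  have cN : c != 0 by rewrite gt_eqF ?kernel_gt0.
  rewrite mulrBr !mulrA kernel_decayz (expfzDr _ _ bN) (expfzDr _ _ cN) !expr1z -!kernel_decayz.
  by congr (_ - _); ring.
rewrite (expfzDr N 1 bN) expr1z.
move: (ravg N g) (ravg (N + 1) g) (b ^ N) (\sum_(i < P) _) => A A' B S.
by field.
Qed.

Lemma ravg_bound N : k <= N -> `|ravg N g| <= M.
Proof.
move=> kN; rewrite /ravg normrM gtr0_norm ?(Vz_gt0 us)// -invr_expz.
rewrite ler_pdivrMl ?(Vz_gt0 us)//.
have ig := ball_integrable kN g_flat.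
have mB : measurable (cball o N) by exact: us_meas us o N.
apply: le_trans (le_normr_Rintegral mB ig) _.
have -> : V ^ N * M = Rintegral m (cball o N) (fun=> M).
  by rewrite Rintegral_cst// (us_vol us) mulrC.
apply: le_Rintegral => //; first exact: integrable_norm.
by apply: (ball_integrable kN (h := fun=> M)).
Qed.

Lemma cvg_decay : 0 < alpha ->
  (fun P : nat => b ^ (k + P%:Z)) @ \oo --> (0 : R).
Proof.
move=> alpha_gt0.
have bN : b != 0 by rewrite gt_eqF ?decay_gt0.
rewrite -(mulr0 (b ^ k)).
have -> : (fun P : nat => b ^ (k + P%:Z)) = (fun P => b ^ k * GRing.exp b P).
  by apply/funext => P; rewrite expfzDr.
apply: cvgMr; apply: cvg_expr.
by rewrite gtr0_norm ?decay_gt0// decay_lt1.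
Qed.

Lemma weight_ge0 y : 0 <= weight y. Proof. exact: powR_ge0. Qed.

Lemma bigcup_balls : \bigcup_P cball o (k + P%:Z) = setT.
Proof.
apply/seteqP; split => // y _; have [n yn] := dist_bounded us o y.
exists `|n%:Z - k|%N => //; apply: le_trans yn _; rewrite (Q_le us); lia.
Qed.

Lemma balls_nondecreasing : nondecreasing_seq (fun P : nat => cball o (k + P%:Z)).
Proof.
move=> i j ij; apply/subsetPset => y /le_trans; apply; rewrite (Q_le us).
by rewrite lerD2l lez_nat.
Qed.

Lemma weight_measurable : measurable_fun setT wg.
Proof. exact (flat_measurable us weight_flat). Qed.

End Spectral.

Section Convergence.
Context {R : realType} {d0} {T : measurableType d0}.
Variables (dist : T -> T -> R) (q : nat) (m : {measure set T -> \bar R}) (d : nat).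
Hypothesis us : ultra_space dist q m d.
Local Notation Q := (q%:R : R).
Variables (o : T) (alpha : R).
Hypothesis alpha_gt0 : 0 < alpha.
Variables (k : int) (g : T -> R) (M : R).
Hypothesis g_flat : flat dist q k setT g.
Hypothesis g_le : forall y, `|g y| <= M.
Hypothesis g0 : forall y, cball dist q o k y -> g y = 0.
Local Notation b := (Q `^ (- alpha)).
Local Notation c := (Q `^ (- alpha - d%:R)).
Local Notation cball := (cball dist q).
Local Notation w := (weight dist d o alpha).

(** The bound is the geometric series of ratio b; it depends on g only through
    M and k. *)
Lemma norm_ball_bound (P : nat) :
  Rintegral m (cball o (k + P%:Z)) (fun y => w y * `|g y|) <=
  M * b ^ (k + 1) / (1 - b).
Proof.
have M0 : 0 <= M := le_trans (normr_ge0 _) (g_le o).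
have b0 := decay_gt0 us alpha; have b1 := decay_lt1 us alpha_gt0.
have gf : flat dist q k setT (fun y => `|g y|).
  by move=> x y _ xy /=; rewrite (g_flat _ xy).
have ng0 y : cball o k y -> `|g y| = 0 by move=> /g0 ->; rewrite normr0.
suff : Rintegral m (cball o (k + P%:Z)) (fun y => w y * `|g y|) <=
    M * b ^ (k + 1) / (1 - b) * (1 - b ^+ P).
  move=> /le_trans; apply; rewrite -subr_ge0 mulrBr mulr1 opprB addrC subrK.
  rewrite !mulr_ge0 ?invr_ge0 ?exprn_ge0 ?exprz_ge0 ?subr_ge0// ltW//.
elim: P => [|P IH].
  rewrite addr0 expr0 subrr mulr0 (@eq_Rintegral _ _ _ _ _ (fun=> 0)).
    by rewrite /Rintegral integral0.
  by move=> y; rewrite inE => /ng0 ->; rewrite mulr0.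
rewrite -addn1 PoszD addrA; have kN : k <= k + P%:Z by lia.
rewrite (shell_integral us alpha gf ng0 kN).
set N := k + P%:Z in IH kN *.
have IN : `|ravg dist q m d o (N + 1) (fun y => `|g y|)| <= M.
  apply: (@ravg_bound _ _ _ _ _ _ _ us o k) => //; last by lia.
  by move=> y; rewrite normr_id.
have I0 : 0 <= Rintegral m (cball o N) (fun y => `|g y|) by exact: Rintegral_ge0.
have S1 : c ^ (N + 1) * (Rintegral m (cball o (N + 1)) (fun y => `|g y|)
     - Rintegral m (cball o N) (fun y => `|g y|)) <= b ^ (N + 1) * M.
  have c0 : 0 < c ^ (N + 1) by exact/exprz_gt0/kernel_gt0/us.
  apply: (@le_trans _ _ (c ^ (N + 1) * Rintegral m (cball o (N + 1)) (fun y => `|g y|))).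
    by rewrite ler_pM2l// gerBl.
  rewrite -(kernel_decayz us) -mulrA ler_pM2l//.
  rewrite -ler_pdivrMl ?(Vz_gt0 us)// invr_expz.
  by apply: le_trans IN; exact: ler_norm.
apply: le_trans (lerD IH S1) _; rewrite le_eqVlt; apply/orP; left; apply/eqP.
have -> : b ^ (N + 1) = b ^ (k + 1) * b ^+ P.
  rewrite (_ : N + 1 = (k + 1) + P%:Z); last by rewrite /N; lia.
  by rewrite expfzDr// gt_eqF.
rewrite addn1 exprS; field; by rewrite subr_eq0 gt_eqF.
Qed.

Lemma weighted_integrable : m.-integrable setT (fun y => (w y * g y)%:E).
Proof.
have gf : flat dist q k setT (fun y => `|g y|).
  by move=> x y _ xy /=; rewrite (g_flat _ xy).
have ng0 y : cball o k y -> `|g y| = 0 by move=> /g0 ->; rewrite normr0.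
have mw := weight_measurable us alpha g_flat g0.
apply/integrableP; split; first exact/measurable_EFinP.
apply: (@le_lt_trans _ _ (M * b ^ (k + 1) / (1 - b))%:E); last exact: ltry.
rewrite -(bigcup_balls us o k).
have mB j : measurable (cball o j) by exact: us_meas us o j.
have cv : (fun P : nat => integral m (cball o (k + P%:Z))
    (fun y => `|(w y * g y)%:E|%E)) @ \oo -->
    integral m (\bigcup_P cball o (k + P%:Z)) (fun y => `|(w y * g y)%:E|%E).
  apply: ge0_nondecreasing_set_cvg_integral => //.
  - exact (balls_nondecreasing us o k).
  - move=> P; apply: measurable_funTS; apply: measurableT_comp => //.
    exact/measurable_EFinP.
apply: (cvge_to_le cv); apply: nearW => P; have kP : k <= k + P%:Z by lia.
have ib := ball_integrable us o kP (weight_flat us alpha gf ng0).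
have -> : integral m (cball o (k + P%:Z)) (fun y => `|(w y * g y)%:E|%E) =
    integral m (cball o (k + P%:Z)) (fun y => (w y * `|g y|)%:E).
  by apply: eq_integral => y _; rewrite /= normrM ger0_norm ?weight_ge0.
rewrite -[leLHS]fineK; last exact: integrable_fin_num ib.
by rewrite lee_fin; exact: norm_ball_bound.
Qed.

Lemma cvg_ball_integral :
  (fun P : nat => Rintegral m (cball o (k + P%:Z)) (fun y => w y * g y)) @ \oo
  --> Rintegral m setT (fun y => w y * g y).
Proof.
have wi := weighted_integrable.
have mB j : measurable (cball o j) by exact: us_meas us o j.
have mw0 := weight_measurable us alpha g_flat g0.
have mw : measurable_fun setT (fun y => (w y * g y)%:E).
  exact/measurable_EFinP/mw0.
have [||_ _ D] := dominated_convergence (mu := m) measurableT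
  (fun P => (measurable_restrictT _ (mB (k + (P : nat)%:Z))).1 (measurable_funTS mw)) mw
  _ (integrable_abse wi).
- apply: aeW => y _; apply: cvg_near_cst.
  have [n yn] := dist_bounded us o y; exists `|n%:Z - k|%N => // P /= nP.
  rewrite patchE mem_set//; apply: le_trans yn _; rewrite (Q_le us); lia.
- apply: aeW => y P _; rewrite patchE; case: ifP => _ //; by rewrite abse0 abse_ge0.
apply: (@fine_cvg _ _ \oo _ _ _); rewrite fineK; last exact: integrable_fin_num wi.
apply: cvg_trans D.
by under eq_fun do rewrite integral_mkcond.
Qed.

Lemma weighted_bound :
  `|Rintegral m setT (fun y => w y * g y)| <= M * b ^ (k + 1) / (1 - b).
Proof.
apply: (cvgr_to_le (cvg_norm cvg_ball_integral)); apply: nearW => P.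
have kP : k <= k + P%:Z by lia.
have mB : measurable (cball o (k + P%:Z)) by exact: us_meas us o _.
apply: le_trans (norm_ball_bound P).
have ib := ball_integrable us o kP (weight_flat us alpha g_flat g0).
apply: le_trans (le_normr_Rintegral mB ib) _.
rewrite le_eqVlt; apply/orP; left; apply/eqP; apply: eq_Rintegral => y _.
by rewrite /= normrM ger0_norm ?weight_ge0.
Qed.

(** The spectral form of D^alpha.  For g y = f (x - y) - f x, the difference of
    averages is A_N f x - A_(N+1) f x with A_N the average over the ball of
    radius q^N.  The weights b^N do not involve the dimension. *)
Lemma spectral_cvg :
  (fun P => \sum_(j < P) b ^ (k + j%:Z) *
     (ravg dist q m d o (k + j%:Z) g - ravg dist q m d o (k + j%:Z + 1) g)) @ \oo -->
  (1 - Q `^ alpha) / (1 - c) * Rintegral m setT (fun y => w y * g y).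
Proof.
have b0 := decay_gt0 us alpha; have b1 := decay_lt1 us alpha_gt0.
have c1 : c < 1.
  have V1 : 1 <= Q ^+ d by rewrite exprn_ege1// ltW// (Q_gt1 us).
  apply: le_lt_trans b1; rewrite -(kernel_decay us) ler_peMr// ltW//; exact: kernel_gt0 us.
have -> : Q `^ alpha = b^-1 by rewrite powRN invrK.
have cN : 1 - c != 0 by rewrite subr_eq0 gt_eqF.
set A := fun N => ravg dist q m d o N g.
have -> : (fun P => \sum_(j < P) b ^ (k + j%:Z) * (A (k + j%:Z) - A (k + j%:Z + 1))) =
  (fun P : nat => (1 - b^-1) / (1 - c) * Rintegral m (cball o (k + P%:Z)) (fun y => w y * g y)
     - (1 - c / b) / (1 - c) * (b ^ (k + P%:Z) * A (k + P%:Z))).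
  apply/funext => P; rewrite mulrAC (ball_abel us alpha g_flat g0) -/A.
  rewrite /A; move: (\sum_(i < P) _) (b ^ _) (ravg _ _ _ _ _ _ _) => S x y.
  field; rewrite cN /=.
  by rewrite gt_eqF.
rewrite -[X in _ --> X]subr0; apply: cvgB.
  by apply: cvgMr; exact: cvg_ball_integral.
rewrite -(mulr0 ((1 - c / b) / (1 - c))); apply: cvgMr.
apply: (@squeeze_cvgr _ _ _ _ (fun P => - (M * b ^ (k + P%:Z)))
                              (fun P => M * b ^ (k + P%:Z))).
- apply: nearW => P; rewrite -ler_norml normrM mulrC.
  rewrite (gtr0_norm (exprz_gt0 _ b0)) ler_pM2r ?exprz_gt0//.
  by apply: (@ravg_bound _ _ _ _ _ _ _ us o k) => //; lia.
- rewrite -oppr0; apply: cvgN; rewrite -(mulr0 M); apply: cvgMr.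
  exact (cvg_decay us k alpha_gt0).
- by rewrite -(mulr0 M); apply: cvgMr; exact (cvg_decay us k alpha_gt0).
Qed.

End Convergence.

(** * The operator on complex-valued functions *)

Section ComplexBounds.
Context {R : realType}.
Implicit Types z : R[i].

Lemma normc_ge_Im z : `|complex.Im z|%:C <= `|z|.
Proof.
rewrite normc_def lecR -sqrtr_sqr ler_wsqrtr// lerDr; exact: sqr_ge0.
Qed.

Lemma normc_le_ReIm z : `|z| <= (`|complex.Re z| + `|complex.Im z|)%:C.
Proof.
have nR (x : R) : `|x%:C| = `|x|%:C.
  by rewrite normc_def /= expr0n addr0 sqrtr_sqr.
rewrite [X in `|X| <= _]complexE rmorphD /=; apply: le_trans (ler_normD _ _) _.
by rewrite normrM normCi mul1r !nR.
Qed.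

Lemma Re_realM (x : R) z : complex.Re (x%:C * z) = x * complex.Re z.
Proof. by rewrite cReM /= mul0r subr0. Qed.

Lemma Im_realM (x : R) z : complex.Im (x%:C * z) = x * complex.Im z.
Proof. by rewrite cImM /= mul0r addr0. Qed.

End ComplexBounds.

Section ComplexOperator.
Context {R : realType} {d0} {T : measurableType d0}.
Variables (dist : T -> T -> R) (q : nat) (m : {measure set T -> \bar R}) (d : nat).
Local Notation Q := (q%:R : R).
Local Notation V := (Q ^+ d).
Local Notation cball := (cball dist q).

(** The domains on which integrals are finite sums over nets. *)
Definition bounded_sat (k : int) (D : set T) : Prop :=
  saturated dist q k D /\ exists o N, k <= N /\ D `<=` cball o N.

Definition cavg (o : T) (N : int) (g : T -> R[i]) : R[i] :=
  (V ^ (- N))%:C * cintegral m (cball o N) g.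

(** To be applied to g y = f (x - y) - f x: this separates the integral from the
    group structure, which T does not carry. *)
Definition vladimirov (o : T) (alpha : R) (g : T -> R[i]) : R[i] :=
  ((1 - Q `^ alpha) / (1 - Q `^ (- alpha - d%:R)))%:C *
  cintegral m setT (fun y => (weight dist d o alpha y)%:C * g y).

(** The properties of the increments f (x - y) - f x of a bounded locally
    constant function that make the integral of the operator converge: local
    constancy kills the singularity at o, boundedness suffices at infinity. *)
Definition tame (o : T) (k : int) (M : R) (g : T -> R[i]) : Prop :=
  [/\ flat dist q k setT g, forall y, `|g y| <= M%:C &
      forall y, cball o k y -> g y = 0].

Hypothesis us : ultra_space dist q m d.

Lemma bounded_sat_net k D : bounded_sat k D -> exists s, net dist q k D s.
Proof. by case=> _ [p [N [kN Do]]]; exact (net_exists us kN Do). Qed.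

Lemma bounded_sat_integrable k D f : bounded_sat k D -> flat dist q k D f -> cintegrable m D f.
Proof. by move=> [sD [p [N [kN Do]]]]; exact (flat_integrable us kN Do sD). Qed.

Lemma bounded_sat_measurable k D : bounded_sat k D -> measurable D.
Proof. by move=> [sD _]; exact (saturated_measurable us sD). Qed.

Lemma cball_bounded_sat o (k N : int) : k <= N -> bounded_sat k (cball o N).
Proof. by move=> kN; split; [exact (cball_saturated us kN) | exists o, N; split]. Qed.

Section Tame.
Variables (o : T) (alpha : R) (k : int) (M : R) (g : T -> R[i]).
Hypothesis alpha_gt0 : 0 < alpha.
Hypothesis tg : tame o k M g.

Lemma tame_Re : [/\ flat dist q k setT (fun y => complex.Re (g y)),
  forall y, `|complex.Re (g y)| <= M &
  forall y, cball o k y -> complex.Re (g y) = 0].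
Proof.
have [gf gM g0] := tg; split.
- by move=> x y _ xy; rewrite (gf x y).
- by move=> y; rewrite -lecR; apply: le_trans (gM y); exact: normc_ge_Re.
- by move=> y /g0 ->.
Qed.

Lemma tame_Im : [/\ flat dist q k setT (fun y => complex.Im (g y)),
  forall y, `|complex.Im (g y)| <= M &
  forall y, cball o k y -> complex.Im (g y) = 0].
Proof.
have [gf gM g0] := tg; split.
- by move=> x y _ xy; rewrite (gf x y).
- by move=> y; rewrite -lecR; apply: le_trans (gM y); exact: normc_ge_Im.
- by move=> y /g0 ->.
Qed.

Lemma vladimirov_Re : complex.Re (vladimirov o alpha g) =
  (1 - Q `^ alpha) / (1 - Q `^ (- alpha - d%:R)) *
  Rintegral m setT (fun y => weight dist d o alpha y * complex.Re (g y)).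
Proof.
rewrite Re_realM; congr (_ * _); apply: eq_Rintegral => y _; exact: Re_realM.
Qed.

Lemma vladimirov_Im : complex.Im (vladimirov o alpha g) =
  (1 - Q `^ alpha) / (1 - Q `^ (- alpha - d%:R)) *
  Rintegral m setT (fun y => weight dist d o alpha y * complex.Im (g y)).
Proof.
rewrite Im_realM; congr (_ * _); apply: eq_Rintegral => y _; exact: Im_realM.
Qed.

Lemma tame_integrable :
  cintegrable m setT (fun y => (weight dist d o alpha y)%:C * g y).
Proof.
have [r1 r2 r3] := tame_Re; have [i1 i2 i3] := tame_Im.
split; under eq_fun do rewrite ?Re_realM ?Im_realM.
  exact (weighted_integrable us alpha_gt0 r1 r2 r3).
exact (weighted_integrable us alpha_gt0 i1 i2 i3).
Qed.

End Tame.

Lemma tame_bound o alpha k M : 0 < alpha ->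
  exists C : R, forall g, tame o k M g -> `|vladimirov o alpha g| <= C%:C.
Proof.
move=> a0.
set c := (1 - Q `^ alpha) / (1 - Q `^ (- alpha - d%:R)).
set b := Q `^ (- alpha); set B := M * b ^ (k + 1) / (1 - b).
exists (`|c| * B + `|c| * B) => g tg.
have [r1 r2 r3] := tame_Re tg; have [i1 i2 i3] := tame_Im tg.
apply: le_trans (normc_le_ReIm _) _; rewrite lecR vladimirov_Re vladimirov_Im !normrM.
apply: lerD; apply: ler_wpM2l => //.
  exact (weighted_bound us a0 r1 r2 r3).
exact (weighted_bound us a0 i1 i2 i3).
Qed.

Lemma vladimirov_sum (I : Type) (s : seq I) (c : I -> R[i]) (f : I -> T -> R[i])
    o alpha k M : 0 < alpha -> (forall i, tame o k M (f i)) ->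
  vladimirov o alpha (fun y => \sum_(i <- s) c i * f i y) =
  \sum_(i <- s) c i * vladimirov o alpha (f i).
Proof.
move=> a0 tf; have ti i := tame_integrable a0 (tf i).
rewrite /vladimirov.
rewrite (@eq_cintegral _ _ _ _ _ _ (fun y => \sum_(i <- s) c i *
  ((weight dist d o alpha y)%:C * f i y))); last first.
  by move=> y _; rewrite mulr_sumr; apply: eq_bigr => i _; rewrite mulrCA.
have [] := @cintegral_sum _ _ _ m _ s (fun i y => c i *
  ((weight dist d o alpha y)%:C * f i y)) setT measurableT.
  by move=> i; exact: cintegrableZ (ti i).
move=> _ ->; rewrite mulr_sumr; apply: eq_bigr => i _.
by rewrite cintegralZ// mulrCA.
Qed.

Lemma ravg_Re o N (g : T -> R[i]) :
  ravg dist q m d o N (fun y => complex.Re (g y)) = complex.Re (cavg o N g).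
Proof. by rewrite Re_realM. Qed.

Lemma ravg_Im o N (g : T -> R[i]) :
  ravg dist q m d o N (fun y => complex.Im (g y)) = complex.Im (cavg o N g).
Proof. by rewrite Im_realM. Qed.

End ComplexOperator.

Section TwoSpaces.
Context {R : realType} {d1 d2} {T1 : measurableType d1} {T2 : measurableType d2}.
Variables (dist1 : T1 -> T1 -> R) (dist2 : T2 -> T2 -> R) (q : nat).
Variables (m1 : {measure set T1 -> \bar R}) (m2 : {measure set T2 -> \bar R}).
Variables (n1 n2 : nat).
Hypothesis us1 : ultra_space dist1 q m1 n1.
Hypothesis us2 : ultra_space dist2 q m2 n2.

(** By spectral_cvg the operator sees only the averages over balls, and sees
    them in the same way in every dimension. *)
Lemma vladimirov_eq (alpha : R) o1 o2 k M g1 g2 : 0 < alpha ->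
  tame dist1 q o1 k M g1 -> tame dist2 q o2 k M g2 ->
  (forall N : int, k <= N ->
     cavg dist1 q m1 n1 o1 N g1 = cavg dist2 q m2 n2 o2 N g2) ->
  vladimirov dist1 q m1 n1 o1 alpha g1 = vladimirov dist2 q m2 n2 o2 alpha g2.
Proof.
move=> a0 t1 t2 E.
have [r1 r2 r3] := tame_Re t1; have [i1 i2 i3] := tame_Im t1.
have [r1' r2' r3'] := tame_Re t2; have [i1' i2' i3'] := tame_Im t2.
have kj (j : nat) : k <= k + j%:Z by lia.
have kj1 (j : nat) : k <= k + j%:Z + 1 by lia.
apply: complex_eqP; rewrite ?vladimirov_Re ?vladimirov_Im.
  apply: (cvg_unique _ _ (spectral_cvg us2 a0 r1' r2' r3')) => //.
  apply: cvg_trans (spectral_cvg us1 a0 r1 r2 r3); apply: near_eq_cvg.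
  by apply: nearW => P; apply: eq_bigr => j _; rewrite !ravg_Re !E.
apply: (cvg_unique _ _ (spectral_cvg us2 a0 i1' i2' i3')) => //.
apply: cvg_trans (spectral_cvg us1 a0 i1 i2 i3); apply: near_eq_cvg.
by apply: nearW => P; apply: eq_bigr => j _; rewrite !ravg_Im !E.
Qed.

(** Over nets of D1 and D2 both sides are the same finite double sum. *)
Lemma cintegral_exchange k1 k2 D1 D2 (f : T1 -> T2 -> R[i]) :
  bounded_sat dist1 q k1 D1 -> bounded_sat dist2 q k2 D2 ->
  (forall y, D2 y -> flat dist1 q k1 D1 (f^~ y)) ->
  (forall x, D1 x -> flat dist2 q k2 D2 (f x)) ->
  cintegral m1 D1 (fun x => cintegral m2 D2 (f x)) =
  cintegral m2 D2 (fun y => cintegral m1 D1 (f^~ y)).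
Proof.
move=> b1 b2 f1 f2.
have [s1 sP1] := bounded_sat_net us1 b1; have [s2 sP2] := bounded_sat_net us2 b2.
have E1 y : D2 y -> cintegral m1 D1 (f^~ y) = _ :=
  fun h => (net_integral us1 sP1 b1.1 (f1 y h)).2.
have E2 x : D1 x -> cintegral m2 D2 (f x) = _ :=
  fun h => (net_integral us2 sP2 b2.1 (f2 x h)).2.
have [_ in1 _ _] := sP1; have [_ in2 _ _] := sP2.
rewrite (net_integral us1 sP1 b1.1 _).2; last first.
  move=> x x' Dx xx'; apply: eq_cintegral => y Dy; exact: f1 Dy _ _ Dx xx'.
rewrite (net_integral us2 sP2 b2.1 _).2; last first.
  move=> y y' Dy yy'; apply: eq_cintegral => x Dx; exact: f2 Dx _ _ Dy yy'.
rewrite big_seq (eq_bigr _ (fun x sx => E2 x (in1 x sx))) -big_seq.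
rewrite [in RHS]big_seq [in RHS](eq_bigr _ (fun y sy => E1 y (in2 y sy))) -big_seq.
rewrite -!mulr_sumr exchange_big /= !mulrA; congr (_ * _); exact: mulrC.
Qed.

End TwoSpaces.

Section MoreIntegral.
Context {R : realType} {d} {T : measurableType d} (m : {measure set T -> \bar R}).

Lemma cintegral_real D (f : T -> R) :
  cintegral m D (fun x => (f x)%:C) = (Rintegral m D f)%:C.
Proof. by rewrite /cintegral /= /Rintegral integral0. Qed.

Lemma cintegral_setD (A B : set T) (f : T -> R[i]) : measurable A -> measurable B ->
  B `<=` A -> cintegrable m A f ->
  cintegral m (A `\` B) f = cintegral m A f - cintegral m B f.
Proof.
move=> mA mB BA fi.
have AE : A = (A `\` B) `|` B by rewrite setUC setDUK.
have mD : measurable (A `\` B) by exact: measurableD.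
have dD : [disjoint A `\` B & B] by apply/disj_setPS => x [[]].
move: fi; rewrite {1 3}AE => -[fr fim]; apply/esym/(canLR (addrK _)).
by apply: complex_eqP; rewrite raddfD /= -Rintegral_setU.
Qed.

Variables (dist : T -> T -> R) (q k : nat).
Hypothesis us : ultra_space dist q m k.

Lemma indicator_integral (o a : T) (N l : int) : l <= N ->
  Rintegral m (cball dist q o N) (fun y => (dist a y <= q%:R ^ l)%R%:R) =
  ((q%:R ^+ k) ^ l) * (dist o a <= q%:R ^ N)%R%:R.
Proof.
move=> lN.
have mA := us_meas us a l; have mo := us_meas us o N.
have -> : (fun y => (dist a y <= q%:R ^ l)%R%:R) = \1_(cball dist q a l) :> (T -> R).
  apply/funext => y; rewrite indicE; congr ((nat_of_bool _)%:R); apply/idP/idP.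
    by move=> h; apply/mem_set.
  by move/set_mem.
rewrite /Rintegral integral_indic//.
have [oa|oa] := boolP (dist o a <= _); last first.
  rewrite mulr0 (_ : _ `&` _ = set0) ?measure0//; apply/seteqP; split => // y [/= ay oy].
  case/negP: oa; apply: (dist_trans us oy); rewrite (us_sym us).
  by apply: le_trans ay _; rewrite (Q_le us).
rewrite mulr1 setIidl ?(us_vol us)// => y /= ay; apply: (dist_trans us oa).
by apply: le_trans ay _; rewrite (Q_le us).
Qed.

End MoreIntegral.

(** * Haar measure of the balls of K *)

Section LocalFieldTheory.
Context {R : realType} {K : topologicalFieldType}.
Variables (abs : K -> R) (q : nat).
Hypothesis habs : normalized_absval abs q.
Local Notation Q := (q%:R : R).

Lemma abs0 : abs 0 = 0. Proof. exact/(absval_eq0 habs). Qed.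

Lemma abs1 : abs 1 = 1.
Proof.
have n0 : abs 1 != 0.
  by apply/eqP => /(absval_eq0 habs) /eqP; rewrite oner_eq0.
by apply: (mulfI n0); rewrite -(absvalM habs) !mulr1.
Qed.

Lemma absN x : abs (- x) = abs x.
Proof.
rewrite -mulN1r (absvalM habs).
suff -> : abs (-1) = 1 by rewrite mul1r.
apply: (@pexpIrn _ 2) => //; rewrite ?nnegrE ?(absval_ge0 habs)//.
by rewrite expr1n expr2 -(absvalM habs) mulrNN mulr1 abs1.
Qed.

Lemma abs_distC x y : abs (x - y) = abs (y - x).
Proof. by rewrite -opprB absN. Qed.

Lemma abs_leD x y r : abs x <= r -> abs y <= r -> abs (x + y) <= r.
Proof. by move=> xr yr; apply: le_trans (absval_ultra habs x y) _; rewrite ge_max xr. Qed.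

Lemma abs_leB x y r : abs x <= r -> abs y <= r -> abs (x - y) <= r.
Proof. by move=> xr yr; apply: abs_leD; rewrite ?absN. Qed.

Lemma abs_neq0 x : x != 0 -> exists k : int, abs x = Q ^ k.
Proof.
move=> x0; have : [set abs x | x in [set x | x != 0]] (abs x) by exists x.
by rewrite (absval_values habs) => -[k _ <-]; exists k.
Qed.

Lemma abs_val x : abs x = 0 \/ exists k : int, abs x = Q ^ k.
Proof.
by have [->|/abs_neq0] := eqVneq x 0; [left; exact: abs0 | right].
Qed.

Lemma abs_surj (k : int) : exists2 x, x != 0 & abs x = Q ^ k.
Proof.
have : [set q%:R ^ N | N in [set: int]] (Q ^ k) by exists k.
by rewrite -(absval_values habs) => -[x x0 <-]; exists x.
Qed.

Lemma absV x : abs x^-1 = (abs x)^-1.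
Proof.
have [->|x0] := eqVneq x 0; first by rewrite invr0 abs0 invr0.
have ax : abs x != 0 by apply/eqP => /(absval_eq0 habs)/eqP; exact/negP.
by apply: (mulfI ax); rewrite -(absvalM habs) !divff ?abs1.
Qed.

Definition residue_class (x : K) : set K := [set y | abs (y - x) < 1].

(** Representatives of the residue field, the only place where its cardinality
    enters. *)
Lemma residue_reps : exists r : nat -> K,
  [/\ forall i, (i < q)%N -> abs (r i) <= 1,
      forall i j, (i < q)%N -> (j < q)%N -> abs (r i - r j) < 1 -> i = j &
      forall x, abs x <= 1 -> exists2 i, (i < q)%N & abs (x - r i) < 1].
Proof.
have /card_set_bijP[f [f1 f2 f3]] : (`I_q #= residue_field abs)%card.
  by rewrite card_eq_sym; exact: absval_residue habs.
have ex i : exists x, (i < q)%N -> abs x <= 1 /\ residue_class x = f i.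
  have [iq|iq] := boolP (i < q)%N; last by exists 0 => iq'; case/negP: iq.
  by have [x x1 xf] := f1 i iq; exists x.
have [r rP] := choice ex; exists r.
have symcl x y z : abs (x - y) < 1 -> abs (z - x) < 1 -> abs (z - y) < 1.
  move=> xy zx; rewrite -(subrKA x) addrC.
  by apply: le_lt_trans (absval_ultra habs _ _) _; rewrite gt_max xy.
have eqcl x y : abs (x - y) < 1 -> residue_class x = residue_class y.
  move=> xy; apply/seteqP; split => z zx; first exact: symcl zx.
  by apply: symcl zx; rewrite abs_distC.
split.
- by move=> i /rP[].
- move=> i j iq jq rij; apply: f2; rewrite ?inE//.
  by have [_ <-] := rP i iq; have [_ <-] := rP j jq; exact: eqcl.
- move=> x x1.
  have [i iq fi] : (f @` `I_q) (residue_class x) by apply: f3; exists x.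
  exists i => //; have [_ e] := rP i iq.
  have : residue_class x x by rewrite /residue_class /= subrr abs0.
  by rewrite -fi -e.
Qed.

Lemma q_gt1 : (1 < q)%N.
Proof.
have [r [r1 r2 r3]] := residue_reps.
have [i iq i1] : exists2 i, (i < q)%N & abs (0 - r i) < 1.
  by apply: r3; rewrite abs0.
have [j jq j1] : exists2 j, (j < q)%N & abs (1 - r j) < 1.
  by apply: r3; rewrite abs1.
suff : i != j by move: iq jq; case: q => [|[|]] //; case: i {i1}; case: j {j1}.
apply/eqP => ij; move: i1 j1; rewrite -ij sub0r absN => i1 j1.
have : abs ((1 - r i) + r i) < 1.
  by apply: le_lt_trans (absval_ultra habs _ _) _; rewrite gt_max j1.
by rewrite subrK abs1 ltxx.
Qed.

Lemma q_gt0 : 0 < Q. Proof. by rewrite ltr0n (ltn_trans _ q_gt1). Qed.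
Lemma qz_gt0 (k : int) : 0 < Q ^ k. Proof. exact: exprz_gt0 q_gt0. Qed.
Lemma q_neq0 : Q != 0. Proof. by rewrite gt_eqF ?q_gt0. Qed.

Lemma q_le (k l : int) : (Q ^ k <= Q ^ l) = (k <= l).
Proof. by apply: ler_eXz2l; rewrite ltr1n q_gt1. Qed.

Lemma q_lt (k l : int) : (Q ^ k < Q ^ l) = (k < l).
Proof. by apply: ltr_eXz2l; rewrite ltr1n q_gt1. Qed.

Lemma abs_lt x (k : int) : (abs x < Q ^ (k + 1)) = (abs x <= Q ^ k).
Proof.
case: (abs_val x) => [->|[j ->]]; first by rewrite qz_gt0 ltW ?qz_gt0.
rewrite q_lt q_le; lia.
Qed.

Definition distK (x y : K) : R := abs (x - y).

Lemma ballK_open (a : K) (k : int) : open [set x | abs (a - x) <= Q ^ k].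
Proof.
rewrite openE => x /= ax; apply/(absval_nbhs habs); exists (Q ^ k); first exact: qz_gt0.
move=> y /= yx; rewrite -(subrKA x); apply: abs_leD => //.
by rewrite abs_distC; exact: ltW.
Qed.

Lemma ballK_measurable (a : K) (k : int) :
  measurable ([set x | abs (a - x) <= Q ^ k] : set (borelType K)).
Proof. by apply: sub_sigma_algebra; exact: ballK_open. Qed.

Lemma ballK_measurable0 (k : int) :
  measurable ([set x | abs x <= Q ^ k] : set (borelType K)).
Proof.
have := ballK_measurable 0 k; congr measurable; apply/seteqP.
by split => x /=; rewrite sub0r absN.
Qed.

Variable mu : {measure set (borelType K) -> \bar R}.
Hypothesis hmu : normalized_haar abs mu.

Lemma ballK_center a (k : int) :
  mu [set x | abs (a - x) <= Q ^ k] = mu [set x | abs x <= Q ^ k].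
Proof.
have [h _] := hmu; rewrite -(h a [set x | abs x <= Q ^ k]).
  congr (mu _); apply/seteqP; split => x /=.
    move=> ax; exists (x - a); last by rewrite addrC subrK.
    by rewrite abs_distC.
  by move=> [y yk <-]; rewrite opprD addNKr absN.
exact: ballK_measurable0.
Qed.

(** A dilation of the residue classes cuts a ball into q translates of the
    ball of the next smaller radius. *)
Lemma ballK_split (k : int) : mu [set x | abs x <= Q ^ (k + 1)] =
  (q%:R%:E * mu [set x : K | (abs x <= Q ^ k)%R])%E.
Proof.
have [r [r1 r2 r3]] := residue_reps.
have [rho rho0 rhoE] := abs_surj (k + 1).
pose F (i : nat) : set (borelType K) := [set x | abs (rho * r i - x) <= Q ^ k].
have scale x : (abs x < 1) = (abs (rho * x) <= Q ^ k).
  rewrite -abs_lt (absvalM habs) rhoE -[X in _ = (_ < X)]mulr1.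
  by rewrite ltr_pM2l ?qz_gt0.
have FE : [set x | abs x <= Q ^ (k + 1)] = \big[setU/set0]_(i < q) F i.
  rewrite -bigcup_mkord; apply/seteqP; split => x /=.
    move=> xk; have [|i iq xi] := r3 (rho^-1 * x).
      by rewrite (absvalM habs) absV rhoE ler_pdivrMl ?qz_gt0// mulr1.
    exists i => //; rewrite /F /=; move: xi; rewrite scale abs_distC.
    by rewrite mulrBr mulrA divff// mul1r.
  move=> [i iq]; rewrite /F /= => xi; rewrite -[x](subKr (rho * r i)).
  apply: abs_leB; last by apply: le_trans xi _; rewrite q_le; lia.
  by rewrite (absvalM habs) rhoE ler_piMr ?(ltW (qz_gt0 _))//; exact: r1.
have mF i : measurable (F i) by exact: ballK_measurable.
rewrite [X in mu X]FE (measure_semi_additive_ord mu (F := fun i : 'I_q => F i))//; last first.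
- by apply: bigsetU_measurable.
- move=> i j _ _ [x [/= ix jx]]; apply/val_inj; apply: (r2 _ _ (ltn_ord i) (ltn_ord j)).
  rewrite scale mulrBr -(subrKA x); apply: abs_leD => //.
  by rewrite abs_distC.
rewrite (eq_bigr (fun=> mu [set x : K | (abs x <= Q ^ k)%R])); last first.
  by move=> i _; exact: ballK_center.
by rewrite big_const_ord iter_addr_0 mule_natl.
Qed.

Lemma ballK_vol (k : int) : mu [set x | abs x <= Q ^ k] = (Q ^ k)%:E.
Proof.
have base : mu [set x | abs x <= Q ^ 0] = 1%:E by have [_] := hmu.
case: k => [|] n.
  elim: n => [|n IH]; first exact: base.
  rewrite -addn1 PoszD ballK_split IH -EFinM expfzDr ?q_neq0// expr1z.
  by rewrite mulrC.
rewrite NegzE; elim: n.+1 => {n} [|n IH]; first by rewrite oppr0 base.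
have := ballK_split (- n.+1%:Z); have -> : - n.+1%:Z + 1 = - n%:Z by lia.
rewrite IH; set X := mu _ => e.
have Xf : (X <= (Q ^ (- n%:Z))%:E)%E.
  rewrite -IH; apply: le_measure; rewrite ?inE.
  - exact: ballK_measurable0.
  - exact: ballK_measurable0.
  - by move=> x /= /le_trans; apply; rewrite q_le; lia.
have X0 : (0 <= X)%E by exact: measure_ge0.
move: X X0 Xf e => [x| |]//= _ _ [] e.
congr (_%:E); apply: (mulfI q_neq0); rewrite -e.
by rewrite -[X in X * _]expr1z -expfzDr ?q_neq0//; congr (_ ^ _); lia.
Qed.

Lemma ultraK : @ultra_space R _ (borelType K) distK q mu 1.
Proof.
split.
- exact: q_gt1.
- by move=> x; rewrite /distK subrr abs0.
- by move=> x y; exact: abs_distC.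
- by move=> x y z; rewrite /distK -(subrKA y); exact: absval_ultra habs _ _.
- by move=> x y; exact: abs_val.
- exact: ballK_measurable.
- by move=> a k; rewrite expr1 -ballK_vol; exact: ballK_center.
Qed.

End LocalFieldTheory.

(** * Norm and product measure on K^n *)

Section RowSpace.
Context {R : realType} {K : topologicalFieldType}.
Variables (abs : K -> R) (q : nat).
Hypothesis habs : normalized_absval abs q.
Local Notation Q := (q%:R : R).
Variable n : nat.
Implicit Types x y : 'rV[K]_n.
Local Notation nrm := (@normn R K abs n).

Lemma normn_leP x r : 0 <= r -> reflect (forall j, abs (x 0 j) <= r) (nrm x <= r).
Proof.
move=> r0; apply: (iffP idP) => [/bigmax_leP[_ h] j|h]; first exact: h.
by apply/bigmax_leP; split => // j _; exact: h.
Qed.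

Lemma normn_leqP x (k : int) :
  reflect (forall j, abs (x 0 j) <= Q ^ k) (nrm x <= Q ^ k).
Proof. by apply: normn_leP; exact: ltW (qz_gt0 habs k). Qed.

Lemma normn_ge0 x : 0 <= nrm x.
Proof. exact: bigmax_ge_id. Qed.

Lemma abs_le_normn x j : abs (x 0 j) <= nrm x.
Proof. exact/normn_leP/lexx/normn_ge0. Qed.

Lemma normn_val x : nrm x = 0 \/ exists k : int, nrm x = Q ^ k.
Proof.
rewrite /normn; elim/big_ind: _ => [|a b ha hb|j _]; first by left.
  by rewrite maxEle; case: ifP.
exact: abs_val habs _.
Qed.

Lemma normnN x : nrm (- x) = nrm x.
Proof. by apply: eq_bigr => j _; rewrite mxE (absN habs). Qed.

Lemma normn_ultra x y : nrm (x + y) <= Num.max (nrm x) (nrm y).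
Proof.
apply/normn_leP; first by rewrite le_max normn_ge0.
move=> j; rewrite mxE; apply: le_trans (absval_ultra habs _ _) _.
by rewrite ge_max !le_max !abs_le_normn /= orbT.
Qed.

Lemma normn0 : nrm 0 = 0.
Proof.
apply/eqP; rewrite eq_le normn_ge0 andbT; apply/normn_leP => // j.
by rewrite mxE (abs0 habs).
Qed.

Lemma normnZ (c : K) x : nrm (c *: x) = abs c * nrm x.
Proof.
rewrite /normn (eq_bigr (fun j => abs c * abs (x 0 j))); last first.
  by move=> j _; rewrite mxE (absvalM habs).
have c0 := absval_ge0 habs c.
elim/big_rec2: _ => [|j a b _ ->]; first by rewrite mulr0.
by rewrite maxr_pMr.
Qed.

Lemma dot_le (u x : 'rV[K]_n) r s : 0 <= r -> 0 <= s -> nrm u <= r -> nrm x <= s ->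
  abs (dot u x) <= r * s.
Proof.
move=> r0 s0 ur xs; rewrite /dot; apply: (big_ind (fun z => abs z <= r * s)).
- by rewrite (abs0 habs) mulr_ge0.
- by move=> a b; exact: abs_leD habs _ _ _.
- move=> j _; rewrite (absvalM habs); apply: ler_pM; rewrite ?(absval_ge0 habs)//.
    exact: le_trans (abs_le_normn u j) ur.
  exact: le_trans (abs_le_normn x j) xs.
Qed.

Lemma dotDr (u x y : 'rV[K]_n) : dot u (x + y) = dot u x + dot u y.
Proof. by rewrite -big_split; apply: eq_bigr => j _; rewrite mxE mulrDr. Qed.

Lemma dotC (u x : 'rV[K]_n) : dot u x = dot x u.
Proof. by apply: eq_bigr => j _; rewrite mulrC. Qed.

Lemma dotNr (u x : 'rV[K]_n) : dot u (- x) = - dot u x.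
Proof. by rewrite -sumrN; apply: eq_bigr => j _; rewrite mxE mulrN. Qed.

Lemma dotZl (c : K) (u x : 'rV[K]_n) : dot (c *: u) x = c * dot u x.
Proof. by rewrite /dot mulr_sumr; apply: eq_bigr => j _; rewrite mxE mulrA. Qed.

Definition distV (x y : 'rV[K]_n) : R := nrm (x - y).

Lemma ballV_open (a : 'rV[K]_n) (k : int) : open [set x | distV a x <= Q ^ k].
Proof.
rewrite openE => x /= /normn_leqP ax.
exists (fun i j => [set y : K | abs (a 0 j - y) <= Q ^ k]).
  move=> i j; rewrite (ord1 i); apply: open_nbhs_nbhs; split.
    exact: ballK_open habs _ _.
  by have := ax j; rewrite !mxE.
by move=> y /= h; apply/normn_leqP => j; rewrite !mxE; exact: h.
Qed.

Variables (mu : {measure set (borelType K) -> \bar R}).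
Hypothesis hmu : normalized_haar abs mu.
Variable (mun : {measure set (borelType 'rV[K]_n) -> \bar R}).
Hypothesis hmun : product_haar mu mun.

Lemma prodEFin (I : Type) (s : seq I) (P : pred I) (f : I -> R) :
  (\prod_(i <- s | P i) (f i)%:E)%E = (\prod_(i <- s | P i) f i)%:E.
Proof. by elim/big_ind2: _ => // a b x y -> ->. Qed.

Lemma ultraV : @ultra_space R _ (borelType 'rV[K]_n) distV q mun n.
Proof.
split.
- exact: q_gt1 habs.
- by move=> x; rewrite /distV subrr normn0.
- by move=> x y; rewrite /distV -opprB normnN.
- by move=> x y z; rewrite /distV -(subrKA y); exact: normn_ultra.
- by move=> x y; exact: normn_val.
- by move=> a k; apply: sub_sigma_algebra; exact: ballV_open.
- move=> a k.
  pose A (j : 'I_n) : set (borelType K) := [set y | abs (a 0 j - y) <= Q ^ k].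
  have mA j : measurable (A j) by exact: ballK_measurable habs _ _.
  have <- : [set x : borelType 'rV[K]_n | forall j, A j (x 0 j)] =
      @cball R _ (borelType 'rV[K]_n) distV q a k.
    apply/seteqP; split => x /= => [h|/normn_leqP h j].
      by apply/normn_leqP => j; rewrite !mxE; exact: h.
    by have := h j; rewrite !mxE.
  rewrite (hmun mA).
  rewrite (eq_bigr (fun=> (Q ^ k)%:E)); last first.
    by move=> j _; exact (etrans (ballK_center habs hmu (a 0 j) k) (ballK_vol habs hmu k)).
  by rewrite prodEFin prodr_const card_ord exprnP exprzAC.
Qed.

End RowSpace.

(** * Plane waves and linear isometries *)

Section PlaneWaves.
Context {R : realType} {K : topologicalFieldType}.
Variables (abs : K -> R) (q : nat).
Hypothesis habs : normalized_absval abs q.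
Local Notation Q := (q%:R : R).
Variable p : nat.
Local Notation n := p.+1.
Local Notation nrm := (@normn R K abs n).
Variables (mu : {measure set (borelType K) -> \bar R}).
Hypothesis hmu : normalized_haar abs mu.
Variable (mun : {measure set (borelType 'rV[K]_n) -> \bar R}).
Hypothesis hmun : product_haar mu mun.
Local Notation dK := (distK abs : borelType K -> borelType K -> R).
Local Notation dV := (@distV R K abs n : borelType 'rV[K]_n -> borelType 'rV[K]_n -> R).
Local Notation BK := (@cball R _ (borelType K) dK q 0).
Local Notation BV := (@cball R _ (borelType 'rV[K]_n) dV q 0).
Local Notation uK := (ultraK habs hmu).
Local Notation uV := (ultraV habs hmu hmun).

Lemma BKE N x : BK N x = (abs x <= Q ^ N) :> Prop.
Proof. by rewrite /cball /distK /= sub0r (absN habs). Qed.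

Lemma BVE N x : BV N x = (nrm x <= Q ^ N) :> Prop.
Proof. by rewrite /cball /distV /= sub0r (normnN habs). Qed.

(** The set on the left is a rectangle. *)
Lemma slab_vol (j : 'I_n) (N : int) (A : set (borelType K)) : measurable A ->
  mun [set y | nrm y <= Q ^ N /\ A (y 0 j)] = (((Q ^ N) ^+ p)%:E * mu (BK N `&` A))%E.
Proof.
move=> mA.
pose F (i : 'I_n) := if i == j then BK N `&` A else BK N.
have mB : measurable (BK N) by exact: us_meas uK 0 N.
have mF i : measurable (F i) by rewrite /F; case: ifP => // _; exact: measurableI.
have <- : [set x : borelType 'rV[K]_n | forall j, F j (x 0 j)] =
    [set y | nrm y <= Q ^ N /\ A (y 0 j)].
  apply/seteqP; split => y /= => [h|[/(normn_leqP habs) h Ay] i].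
    split; last by have := h j; rewrite /F eqxx => -[].
    apply/(normn_leqP habs) => i; rewrite -[is_true _]BKE.
    by have := h i; rewrite /F; case: ifP => // _ [].
  have : BK N (y 0 i) by rewrite BKE.
  by rewrite /F; case: ifP => // /eqP ->.
rewrite (hmun mF) (bigD1 j)//= {1}/F eqxx muleC; congr (_ * _)%E.
rewrite (eq_bigr (fun=> (Q ^ N)%:E)); last first.
  by move=> i /negbTE ij; rewrite /F ij; have := us_vol uK 0 N; rewrite expr1.
rewrite prodEFin prodr_const; congr ((_ ^+ _)%:E).
by rewrite (eq_card (B := predC1 j)) ?cardC1 ?card_ord.
Qed.

(** The j-th coordinate maps Haar measure on a ball of K^n to a multiple of Haar
    measure on the ball of K, by slab_vol. *)
Lemma coord_integral (j : 'I_n) (k N : int) (g : K -> R[i]) : k <= N ->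
  flat dK q k (BK N) g ->
  cintegral mun (BV N) (fun y => g (y 0 j)) =
  ((Q ^ N) ^+ p)%:C * cintegral mu (BK N) g.
Proof.
move=> kN gf.
have bs : bounded_sat dK q k (BK N) by exact (cball_bounded_sat uK 0 kN).
have [s sP] := bounded_sat_net uK bs; have [us_ sD sep cov] := sP.
rewrite (net_integral uK sP bs.1 gf).2.
pose A (b : K) : set (borelType 'rV[K]_n) :=
  [set y | nrm y <= Q ^ N /\ cball dK q b k (y 0 j)].
have mA b : measurable (A b).
  suff -> : A b = BV N `&` [set y | cball dK q b k (y 0 j)].
    apply: measurableI; first exact: us_meas uV 0 N.
    apply: (saturated_measurable uV (k := k)) => y z /= by_ yz.
    apply: (dist_trans uK by_).
    by have := abs_le_normn abs (y - z) j; rewrite !mxE => /le_trans; apply.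
  by apply/seteqP; split => y; [move=> [? ?]; split; rewrite ?BVE | case; rewrite BVE].
have AE b : b \in s -> mun (A b) = ((Q ^ N) ^+ p * Q ^ k)%:E.
  move=> sb; rewrite slab_vol; last exact: us_meas uK b k.
  rewrite setIidr; first by rewrite (us_vol uK) expr1 EFinM.
  move=> y by_; exact: bs.1 (sD b sb) by_.
have [||||||_ ->] := @cintegral_pieces _ _ _ mun K s A g (BV N) (fun y => g (y 0 j)).
- exact: mA.
- by move=> b /AE ->; exact: ltry.
- exact: us_.
- move=> a b sa sb [y [[_ ay] [_ by_]]]; apply: sep => //.
  by apply: (dist_trans uK ay); rewrite (us_sym uK).
- move=> y; rewrite BVE; split => [yN|[b _ []//]].
  have [b sb yb] : exists2 b, b \in s & dK b (y 0 j) <= Q ^ k.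
    by apply: cov; rewrite BKE; exact: le_trans (abs_le_normn abs y j) yN.
  by exists b.
- by move=> b y sb [_ yb]; rewrite (gf b (y 0 j))//; exact: sD.
rewrite mulrA -rmorphM expr1 mulr_sumr big_seq [RHS]big_seq; apply: eq_bigr => b sb.
by rewrite AE//= mulrC.
Qed.

(** The linear change of coordinates that replaces the j-th coordinate of y by
    dot u y.  It is an isometry when |u| = |u_j| = 1, and it lets a plane wave be
    treated as a function of one coordinate. *)
Definition straighten (u : 'rV[K]_n) (j : 'I_n) (y : 'rV[K]_n) : 'rV[K]_n :=
  \row_i (if i == j then dot u y else y 0 i).

(** The values of the absolute value are discrete, so the maximum defining the
    norm being 1 forces one coordinate to be a unit. *)
Lemma unit_coord (u : 'rV[K]_n) : nrm u = 1 -> exists j, abs (u 0 j) = 1.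
Proof.
move=> u1; apply: contrapT => nj.
have : nrm u <= Q ^ (-1).
  apply/(normn_leqP habs) => j; rewrite -(abs_lt habs) addNr expr0z lt_neqAle.
  rewrite -{2}u1 abs_le_normn andbT; apply/eqP => h; apply: nj; by exists j.
by rewrite u1 -[1](expr0z Q) (q_le habs).
Qed.

Lemma straighten_isometry (u : 'rV[K]_n) j y : nrm u = 1 -> abs (u 0 j) = 1 ->
  nrm (straighten u j y) = nrm y.
Proof.
move=> u1 uj; apply/eqP; rewrite eq_le; apply/andP; split.
  apply/normn_leP => [|i]; first exact: normn_ge0.
  rewrite mxE; case: ifP => _; last exact: abs_le_normn.
  by rewrite -[leRHS]mul1r; apply: (dot_le habs); rewrite ?u1 ?normn_ge0.
apply/normn_leP => [|i]; first exact: normn_ge0.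
have off l : l != j -> abs (y 0 l) <= nrm (straighten u j y).
  move=> lj; have := abs_le_normn abs (straighten u j y) l.
  by rewrite mxE (negbTE lj).
have [->|] := eqVneq i j; last exact: off.
have uj0 : u 0 j != 0.
  by apply/eqP => /(absval_eq0 habs)/eqP; rewrite uj oner_eq0.
have -> : y 0 j = (u 0 j)^-1 * (dot u y - \sum_(l < n | l != j) u 0 l * y 0 l).
  by rewrite /dot (bigD1 j)//= addrK mulrA mulVf// mul1r.
rewrite (absvalM habs) (absV habs) uj invr1 mul1r.
apply: (abs_leB habs).
  by have := abs_le_normn abs (straighten u j y) j; rewrite mxE eqxx.
apply: (big_ind (fun z => abs z <= nrm (straighten u j y))).
- by rewrite (abs0 habs) normn_ge0.
- by move=> a b; exact: abs_leD habs _ _ _.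
- move=> l lj; rewrite (absvalM habs) -[leRHS]mul1r; apply: ler_pM.
  + exact: absval_ge0 habs _.
  + exact: absval_ge0 habs _.
  + by rewrite -u1; exact: abs_le_normn.
  + exact: off.
Qed.

Lemma straightenB (u : 'rV[K]_n) j x y :
  straighten u j x - straighten u j y = straighten u j (x - y).
Proof.
by apply/rowP => i; rewrite !mxE; case: ifP => _ //; rewrite dotDr dotNr.
Qed.

Lemma straighten_onto (u : 'rV[K]_n) j z : abs (u 0 j) = 1 -> exists y, straighten u j y = z.
Proof.
move=> uj.
have uj0 : u 0 j != 0.
  by apply/eqP => /(absval_eq0 habs)/eqP; rewrite uj oner_eq0.
exists (\row_i (if i == j then (u 0 j)^-1 * (z 0 j - \sum_(l < n | l != j) u 0 l * z 0 l)
                else z 0 i)).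
apply/rowP => i; rewrite !mxE; case: ifP => [/eqP ->|-> //].
rewrite /dot (bigD1 j)//= mxE eqxx mulrA divff// mul1r.
rewrite [X in _ + X](eq_bigr (fun l => u 0 l * z 0 l)) ?subrK//.
by move=> l /negbTE lj; rewrite mxE lj.
Qed.

(** Straightening u reduces a plane wave to a function of one coordinate. *)
Lemma plane_integral (u : 'rV[K]_n) (k N : int) (g : K -> R[i]) : k <= N ->
  nrm u = 1 -> flat dK q k (BK N) g ->
  cintegral mun (BV N) (fun y => g (dot u y)) =
  ((Q ^ N) ^+ p)%:C * cintegral mu (BK N) g.
Proof.
move=> kN u1 gf; have [j uj] := unit_coord u1.
rewrite -(coord_integral j kN gf).
have bs : bounded_sat dV q k (BV N) by exact (cball_bounded_sat uV 0 kN).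
rewrite -[RHS](isometry_integral uV (phi := straighten u j) kN (fun _ => id) bs.1 bs.1).
- by apply: eq_cintegral => y _; rewrite /= mxE eqxx.
- move=> x y; rewrite BVE => xN xy; apply: gf.
    by rewrite BKE; exact: le_trans (abs_le_normn abs x j) xN.
  by have := abs_le_normn abs (x - y) j; rewrite !mxE => /le_trans; apply.
- by move=> x y; rewrite /distV straightenB straighten_isometry.
- by move=> x; rewrite !BVE straighten_isometry.
- move=> y; rewrite BVE => yN; have [x xy] := straighten_onto y uj.
  by exists x => //; rewrite BVE -(straighten_isometry x u1 uj) xy.
Qed.

(** With plane_integral: a plane wave and its profile have the same averages. *)
Lemma avg_scale (N : int) :
  ((Q ^+ n) ^ (- N))%:C * ((Q ^ N) ^+ p)%:C = ((Q ^+ 1) ^ (- N))%:C :> R[i].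
Proof.
rewrite -rmorphM; congr (_%:C).
rewrite expr1 (exprzAC Q n%:Z (- N)) [_ ^ n%:Z]exprS -mulrA -exprMn -expfzDr.
  by rewrite addNr expr0z expr1n mulr1.
exact: q_neq0 habs.
Qed.

End PlaneWaves.

(** * Superpositions of plane waves *)

Section Superposition.
Context {R : realType} {K : topologicalFieldType}.
Variables (abs : K -> R) (q : nat).
Hypothesis habs : normalized_absval abs q.
Local Notation Q := (q%:R : R).
Variable p : nat.
Local Notation n := p.+1.
Local Notation nrm := (@normn R K abs n).
Variables (mu : {measure set (borelType K) -> \bar R}).
Hypothesis hmu : normalized_haar abs mu.
Variable (mun : {measure set (borelType 'rV[K]_n) -> \bar R}).
Hypothesis hmun : product_haar mu mun.
Local Notation dK := (distK abs : borelType K -> borelType K -> R).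
Local Notation dV := (@distV R K abs n : borelType 'rV[K]_n -> borelType 'rV[K]_n -> R).
Local Notation BK := (@cball R _ (borelType K) dK q 0).
Local Notation BV := (@cball R _ (borelType 'rV[K]_n) dV q 0).
Local Notation uK := (ultraK habs hmu).
Local Notation uV := (ultraV habs hmu hmun).

Local Notation S := ([set u : 'rV[K]_n | nrm u = 1] : set (borelType 'rV[K]_n)).

(** The bound and the scale of local constancy are explicit because they must be
    uniform in the direction u. *)
Definition profile (k : int) (M : R) (e : K -> R[i]) : Prop :=
  (forall r r', abs (r - r') <= Q ^ k -> e r = e r') /\
  (forall r, `|e r| <= M%:C).

Definition radial (e : K -> R[i]) : Prop :=
  forall w r, abs w = 1 -> e (w * r) = e r.

Lemma DalphaE (alpha : R) (f : K -> R[i]) x :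
  Dalpha abs q mu alpha f x =
  vladimirov dK q mu 1 0 alpha (fun y => f (x - y) - f x).
Proof.
rewrite /Dalpha /vladimirov /weight (mulr1n 1).
apply: (congr1 (fun z => _ * z)); apply: eq_cintegral => y _.
by rewrite /distK sub0r (absN habs).
Qed.

Lemma DalphanE (alpha : R) (f : 'rV[K]_n -> R[i]) x :
  Dalphan abs q mun alpha f x =
  vladimirov dV q mun n 0 alpha (fun y => f (x - y) - f x).
Proof.
rewrite /Dalphan /vladimirov /weight.
apply: (congr1 (fun z => _ * z)); apply: eq_cintegral => y _.
by rewrite /distV sub0r (normnN habs).
Qed.

Lemma increment_bound (V : zmodType) (f : V -> R[i]) M : (forall x, `|f x| <= M%:C) ->
  forall x y, `|f y - f x| <= (M + M)%:C.
Proof.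
move=> fM x y; rewrite rmorphD; apply: le_trans (ler_normB _ _) _.
exact: lerD.
Qed.

Lemma increment_tame k M f x : profile k M f ->
  tame dK q 0 k (M + M) (fun y => f (x - y) - f x).
Proof.
move=> [fk fM]; split.
- move=> y z _ yz; congr (_ - _); apply: fk.
  by rewrite opprB addrC subrKA (abs_distC habs).
- by move=> y; exact: increment_bound.
- move=> y; rewrite -[cball _ _ _ _ _]/(BK k y) (BKE habs) => yk.
  by rewrite (fk (x - y) x) ?subrr// addrAC subrr sub0r (absN habs).
Qed.

Lemma Dnat_sum (I : Type) (s : seq I) (c : I -> R[i]) (f : I -> K -> R[i]) m k M t :
  (forall i, profile k M (f i)) ->
  Dnat abs q mu m (fun t => \sum_(i <- s) c i * f i t) t =
  \sum_(i <- s) c i * Dnat abs q mu m (f i) t.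
Proof.
case: m => [//|m] fP /=.
have : 0 < m.+1%:R :> R by rewrite ltr0n.
move: m.+1%:R => alpha a0; rewrite DalphaE.
have tf i := increment_tame t (fP i).
transitivity (\sum_(i <- s) c i *
    vladimirov dK q mu 1 0 alpha (fun y => f i (t - y) - f i t)); last first.
  by apply: eq_bigr => i _; rewrite DalphaE.
rewrite -(vladimirov_sum uK s c a0 tf); congr vladimirov; apply/funext => y.
by rewrite -sumrB; apply: eq_bigr => i _; rewrite mulrBr.
Qed.

Lemma Dnat_shift m (f : K -> R[i]) b t :
  Dnat abs q mu m (fun t => f (t + b)) t = Dnat abs q mu m f (t + b).
Proof.
case: m => [//|m] /=; rewrite !DalphaE; congr vladimirov; apply/funext => y.
by rewrite addrAC.
Qed.

Lemma Dnat_profile m k M : exists M', forall f, profile k M f ->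
  profile k M' (Dnat abs q mu m f).
Proof.
case: m => [|m]; first by exists M.
have m0 : 0 < m.+1%:R :> R by rewrite ltr0n.
have [C CP] := @tame_bound _ _ _ _ _ _ _ uK 0 m.+1%:R k (M + M) m0.
exists C => f fP; split => [r r' rr'|r] /=; rewrite !DalphaE.
  congr vladimirov; apply/funext => y; rewrite (fP.1 r r')//; congr (_ - _).
  by apply: fP.1; rewrite opprB addrA subrK.
by apply: CP; exact: increment_tame.
Qed.

Lemma scale_integral (w : K) (k N : int) (f : K -> R[i]) : k <= N -> abs w = 1 ->
  flat dK q k setT f ->
  cintegral mu (BK N) (fun y => f (w * y)) = cintegral mu (BK N) f.
Proof.
move=> kN w1 ff.
have w0 : w != 0 by apply/eqP => /(absval_eq0 habs)/eqP; rewrite w1 oner_eq0.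
have bs : bounded_sat dK q k (BK N) by exact (cball_bounded_sat uK 0 kN).
apply: (isometry_integral uK (phi := fun y => w * y) kN (fun _ => id) bs.1 bs.1).
- by move=> x y _ xy; exact: ff.
- by move=> x y; rewrite /distK -mulrBr (absvalM habs) w1 mul1r.
- by move=> x; rewrite !(BKE habs) (absvalM habs) w1 mul1r.
- move=> y; rewrite (BKE habs) => yN; exists (w^-1 * y).
    by rewrite (BKE habs) (absvalM habs) (absV habs) w1 invr1 mul1r.
  by rewrite mulrA divff// mul1r.
Qed.

(** The spectral form reduces the claim to averages over balls around 0, which
    multiplication by a unit preserves. *)
Lemma Dnat_radial m k M f : profile k M f -> radial f ->
  radial (Dnat abs q mu m f).
Proof.
case: m => [//|m] fP fr w t w1 /=; rewrite !DalphaE.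
have m0 : 0 < m.+1%:R :> R by rewrite ltr0n.
apply: (vladimirov_eq uK uK m0 (increment_tame (w * t) fP) (increment_tame t fP)).
move=> N kN; rewrite /cavg; congr (_ * _).
rewrite -(scale_integral kN w1 (f := fun y => f (w * t - y) - f (w * t))).
  by apply: eq_cintegral => y _; rewrite -mulrBr !fr.
by have [] := increment_tame (w * t) fP.
Qed.

Section Family.
Variables (k k2 : int) (M : R) (H : 'rV[K]_n -> K -> R[i]).
Hypothesis HP : forall u, profile k M (H u).
Hypothesis Hu : forall u u' r, nrm u = 1 -> nrm (u - u') <= Q ^ k2 -> H u r = H u' r.
Hypothesis Hr : forall w u r, abs w = 1 -> H (w *: u) (w * r) = H u r.

Definition superpose (t : K) (x : 'rV[K]_n) : R[i] :=
  cintegral mun S (fun u => H u (t + dot u x)).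

Lemma sphere_bounded_sat l : l <= -1 -> bounded_sat dV q l S.
Proof.
move=> l1; split; last first.
  exists 0, 0; split; first by lia.
  by move=> u /= u1; rewrite -[cball _ _ _ _ _]/(BV 0 u) (BVE habs) u1 expr0z.
move=> u v /= u1 uv.
have h : ~ dV 0 u <= Q ^ l.
  rewrite /distV sub0r (normnN habs) u1 -[1](expr0z Q) (q_le habs); lia.
have := dist_far uV uv h.
by rewrite /distV !sub0r !(normnN habs) u1.
Qed.

(** For x in a bounded set the integrand is constant in u on balls of one fixed
    radius: the integral over the sphere becomes one finite sum, with nodes that
    depend neither on t nor on x. *)
Lemma sphere_level (X : int) : exists2 l : int, l <= -1 &
  forall u v, nrm u = 1 -> nrm (u - v) <= Q ^ l ->
  forall t x, nrm x <= Q ^ X -> H u (t + dot u x) = H v (t + dot v x).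
Proof.
(* Scale q^-1 keeps u on the sphere, q^k2 controls H, and q^(k - X) controls
   the argument u.x when |x| <= q^X. *)
exists (Num.min (-1) (Num.min k2 (k - X))); first by lia.
move=> u v u1 uv t x xX.
have uv2 : nrm (u - v) <= Q ^ k2 by apply: le_trans uv _; rewrite (q_le habs); lia.
rewrite (Hu _ u1 uv2); apply: (HP v).1.
rewrite opprD addrACA subrr add0r dotC [dot v x]dotC -dotNr -dotDr dotC.
have -> : Q ^ k = Q ^ (k - X) * Q ^ X by rewrite -expfzDr ?(q_neq0 habs)// subrK.
apply: (dot_le habs) => //; rewrite ?(ltW (qz_gt0 habs _))//.
by apply: le_trans uv _; rewrite (q_le habs); lia.
Qed.

Lemma norm_le_pow (x : 'rV[K]_n) : exists X : int, nrm x <= Q ^ X.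
Proof.
case: (normn_val habs x) => [->|[j ->]]; last by exists j.
by exists 0; rewrite expr0z ler01.
Qed.

Lemma sphere_integral_bound f C l : l <= -1 -> flat dV q l S f ->
  (forall u, S u -> `|f u| <= C%:C) -> 0 <= C -> `|cintegral mun S f| <= C%:C.
Proof.
move=> l1 ff fC C0; have bs := sphere_bounded_sat l1.
have [s sP] := bounded_sat_net uV bs; have [us_ sD sep cov] := sP.
rewrite (net_integral uV sP bs.1 ff).2 normrM.
have V0 : 0 < (Q ^+ n) ^ l by exact: (Vz_gt0 uV).
have -> : `|((Q ^+ n) ^ l)%:C| = ((Q ^+ n) ^ l)%:C.
  by rewrite ger0_norm// ler0c ltW.
have : `|\sum_(a <- s) f a| <= ((size s)%:R * C)%:C.
  apply: le_trans (ler_norm_sum _ _ _) _.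
  rewrite big_seq; apply: (@le_trans _ _ (\sum_(a <- s) C%:C)).
    by rewrite [leRHS]big_seq; apply: ler_sum => a sa; exact: fC (sD a sa).
  by rewrite big_const_seq count_predT iter_addr_0 -rmorphMn mulr_natl.
move=> h; apply: le_trans (_ : ((Q ^+ n) ^ l * ((size s)%:R * C))%:C <= _).
  by rewrite rmorphM; apply: ler_wpM2l => //; rewrite ler0c ltW.
rewrite lecR mulrA ler_piMl//.
have l0 : l <= 0 by lia.
have := separated_size uV (o := 0) l0 us_ _ sep; rewrite expr0z mulrC; apply.
by move=> a /sD /= a1; rewrite -[cball _ _ _ _ _]/(BV 0 a) (BVE habs) a1 expr0z.
Qed.

Lemma M_ge0 : 0 <= M.
Proof. by rewrite -lecR; apply: le_trans ((HP 0).2 0); exact: normr_ge0. Qed.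

Lemma superpose_bound t x : `|superpose t x| <= M%:C.
Proof.
have [X xX] := norm_le_pow x; have [l l1 lP] := sphere_level X.
apply: (sphere_integral_bound l1); [|by move=> u _; exact: (HP u).2|exact: M_ge0].
by move=> u v u1 uv; exact: lP.
Qed.

Lemma superpose_lc t t' x x' : abs t' <= Q ^ k -> nrm x' <= Q ^ k ->
  superpose (t + t') (x + x') = superpose t x.
Proof.
move=> tk xk; apply: eq_cintegral => u /= u1; apply: (HP u).1.
rewrite dotDr opprD addrACA [t + t']addrC addrK [dot u x + _]addrC addrK.
apply: (abs_leD habs) => //; rewrite -[leRHS]mul1r.
by apply: (dot_le habs); rewrite ?u1// ltW// (qz_gt0 habs).
Qed.

(** Rotate the directions: u |-> w u preserves the sphere. *)
Lemma superpose_radial w t x : abs w = 1 -> superpose (w * t) x = superpose t x.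
Proof.
move=> w1.
have w0 : w != 0 by apply/eqP => /(absval_eq0 habs)/eqP; rewrite w1 oner_eq0.
have [X xX] := norm_le_pow x; have [l l1 lP] := sphere_level X.
have bs := sphere_bounded_sat l1; have [_ [oo [N [lN So]]]] := bs.
rewrite /superpose.
rewrite -[LHS](isometry_integral uV (phi := fun u => w *: u) lN So bs.1 bs.1).
- by apply: eq_cintegral => u _ /=; rewrite dotZl -mulrDr Hr.
- by move=> u v u1 uv; exact: lP.
- by move=> u v; rewrite /distV -scalerBr (normnZ habs) w1 mul1r.
- by move=> u /= u1; rewrite (normnZ habs) w1 u1 mulr1.
- move=> v /= v1; exists (w^-1 *: v).
    by rewrite /= (normnZ habs) (absV habs) w1 v1 invr1 mulr1.
  by rewrite scalerA divff// scale1r.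
Qed.

(** The mean value property behind the equation: plane waves with |u| = 1
    satisfy it by plane_integral, and both averages commute with the integral
    over the sphere. *)
Lemma superpose_mean (N : int) t x : k <= N ->
  cavg dV q mun n 0 N (fun y => superpose t (x - y) - superpose t x) =
  cavg dK q mu 1 0 N (fun y => superpose (t - y) x - superpose t x).
Proof.
move=> kN; have [X0 xX0] := norm_le_pow x.
have [X [NX xX]] : exists X : int, N <= X /\ nrm x <= Q ^ X.
  exists (Num.max N X0); split; first by lia.
  by apply: le_trans xX0 _; rewrite (q_le habs); lia.
have xyX y : BV N y -> nrm (x - y) <= Q ^ X.
  rewrite (BVE habs) => yN; apply: le_trans (normn_ultra habs _ _) _.
  rewrite ge_max xX (normnN habs); apply: le_trans yN _; by rewrite (q_le habs).
have [l l1 lP] := sphere_level X; have bS := sphere_bounded_sat l1.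
have mS : measurable S := bounded_sat_measurable uV bS.
have bV : bounded_sat dV q k (BV N) by exact (cball_bounded_sat uV 0 kN).
have bK : bounded_sat dK q k (BK N) by exact (cball_bounded_sat uK 0 kN).
(* Shifting x by -y or t by -s shifts the argument of H u by -u.y or -s. *)
pose g u s := H u (t + dot u x - s) - H u (t + dot u x).
have iS t' x' : nrm x' <= Q ^ X -> cintegrable mun S (fun u => H u (t' + dot u x')).
  move=> x'X; apply: (bounded_sat_integrable uV bS) => u v u1 uv; exact: lP.
have gK u : flat dK q k (BK N) (g u).
  move=> r s _ rs; congr (_ - _); apply: (HP u).1.
  by rewrite opprB addrC addrA subrK (abs_distC habs).
have gS s u v : S u -> dV u v <= Q ^ l -> g u s = g v s.
  move=> u1 uv; rewrite /g (addrAC t (dot u x)) (addrAC t (dot v x)).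
  by rewrite (lP u v u1 uv (t - s) x xX) (lP u v u1 uv t x xX).
rewrite /cavg (@eq_cintegral _ _ _ mun (BV N) _
  (fun y => cintegral mun S (fun u => g u (dot u y)))); last first.
  move=> y yN; rewrite -(cintegralB mS (iS t _ (xyX y yN)) (iS t x xX)).
  by apply: eq_cintegral => u _; rewrite /g dotDr dotNr addrA.
rewrite (cintegral_exchange uV uV bV bS); first last.
- move=> y yN u v u1 uv; rewrite /g -!addrA -!dotNr -!dotDr.
  by rewrite (lP u v u1 uv t (x - y) (xyX y yN)) (lP u v u1 uv t x xX).
- move=> u /= u1 y z _ yz; congr (_ - _); apply: (HP u).1.
  rewrite opprB addrC addrA subrK (abs_distC habs) -dotNr -dotDr -[leRHS]mul1r.
  by apply: (dot_le habs); rewrite ?u1// ltW// (qz_gt0 habs).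
rewrite (@eq_cintegral _ _ _ mun S _
  (fun u => ((Q ^ N) ^+ p)%:C * cintegral mu (BK N) (g u))); last first.
  by move=> u /= u1; exact: (plane_integral habs hmu hmun kN u1 (gK u)).
rewrite cintegralZ//; last first.
  apply: (bounded_sat_integrable uV bS) => u v u1 uv; apply: eq_cintegral => s _.
  exact: gS.
rewrite mulrA (avg_scale habs); congr (_ * _).
rewrite (cintegral_exchange uV uK bS bK).
- apply: eq_cintegral => s _; rewrite -(cintegralB mS (iS (t - s) x xX) (iS t x xX)).
  by apply: eq_cintegral => u _; rewrite /g addrAC.
- by move=> s _ u v; exact: gS.
- by move=> u _; exact: gK.
Qed.

Lemma superpose_profile x : profile k M (superpose^~ x).
Proof.
split=> [r r' rr'|r]; last exact: superpose_bound.
rewrite -(@superpose_lc r' (r - r') x 0)//; first by rewrite addr0 addrC subrK.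
by rewrite (normn0 habs) ltW// (qz_gt0 habs).
Qed.

Lemma superpose_wave alpha t x : 0 < alpha ->
  Dalpha abs q mu alpha (superpose^~ x) t = Dalphan abs q mun alpha (superpose t) x.
Proof.
move=> a0; rewrite DalphaE DalphanE; apply/esym.
apply: (vladimirov_eq uV uK a0 (M := M + M) (k := k)).
- have lcx y z : nrm (y - z) <= Q ^ k -> superpose t y = superpose t z.
    move=> yz; rewrite -(@superpose_lc t 0 z (y - z))//.
      by rewrite addr0 addrC subrK.
    by rewrite (abs0 habs) ltW// (qz_gt0 habs).
  split.
  + move=> y z _ yz; congr (_ - _); apply: lcx.
    by rewrite opprB addrC addrA subrK -opprB (normnN habs).
  + by move=> y; apply: increment_bound => z; exact: superpose_bound.
  + move=> y; rewrite -[cball _ _ _ _ _]/(BV k y) (BVE habs) => yk.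
    by rewrite (lcx (x - y) x) ?subrr// addrAC subrr sub0r (normnN habs).
- exact: increment_tame (superpose_profile x).
- by move=> N kN; exact: superpose_mean.
Qed.

(** For fixed x the superposition is, for all t at once, one finite sum of
    plane waves, on which the operator acts term by term. *)
Lemma superpose_Dnat m t x : Dnat abs q mu m (superpose^~ x) t =
  cintegral mun S (fun u => Dnat abs q mu m (fun t' => H u (t' + dot u x)) t).
Proof.
have [X xX] := norm_le_pow x; have [l l1 lP] := sphere_level X.
have bs := sphere_bounded_sat l1; have [s sP] := bounded_sat_net uV bs.
have -> : superpose^~ x = fun t' =>
    \sum_(u <- s) ((Q ^+ n) ^ l)%:C * H u (t' + dot u x).
  apply/funext => t'; rewrite -mulr_sumr; apply: (net_integral uV sP bs.1 _).2.
  by move=> u v u1 uv; exact: lP.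
rewrite (Dnat_sum _ _ _ _ (k := k) (M := M)) => [|u].
  rewrite -mulr_sumr; apply/esym; apply: (net_integral uV sP bs.1 _).2.
  move=> u v u1 uv; congr Dnat; apply/funext => t'; exact: lP.
split=> [r r' rr'|r]; last exact: (HP u).2.
by apply: (HP u).1; rewrite opprD addrACA subrr addr0.
Qed.

End Family.
End Superposition.

(** * Spherical integrals of the fundamental profile *)

Section Source.
Context {R : realType} {K : topologicalFieldType}.
Variables (abs : K -> R) (q : nat).
Hypothesis habs : normalized_absval abs q.
Local Notation Q := (q%:R : R).
Variable p : nat.
Local Notation n := p.+1.
Local Notation nrm := (@normn R K abs n).
Variables (mu : {measure set (borelType K) -> \bar R}).
Hypothesis hmu : normalized_haar abs mu.
Variable (mun : {measure set (borelType 'rV[K]_n) -> \bar R}).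
Hypothesis hmun : product_haar mu mun.
Local Notation dK := (distK abs : borelType K -> borelType K -> R).
Local Notation dV := (@distV R K abs n : borelType 'rV[K]_n -> borelType 'rV[K]_n -> R).
Local Notation BK := (@cball R _ (borelType K) dK q 0).
Local Notation BV := (@cball R _ (borelType 'rV[K]_n) dV q 0).
Local Notation uK := (ultraK habs hmu).
Local Notation uV := (ultraV habs hmu hmun).

Local Notation S := ([set u : 'rV[K]_n | nrm u = 1] : set (borelType 'rV[K]_n)).

Definition ind (k : int) (r : K) : R := (abs r <= Q ^ k)%R%:R.

Lemma ind_integral (k N : int) r : k <= N ->
  Rintegral mu (BK N) (fun y => ind k (r - y)) = Q ^ k * ind N r.
Proof.
move=> kN; have := indicator_integral uK 0 r kN.
by rewrite expr1 /distK sub0r (absN habs).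
Qed.

Lemma ind_const (k : int) r r' : abs (r - r') <= Q ^ k -> ind k r = ind k r'.
Proof.
move=> rr'; rewrite /ind; congr ((nat_of_bool _)%:R); apply/idP/idP => h.
  by rewrite -[r'](subKr r); exact: (abs_leB habs h rr').
by rewrite -[r](subrK r'); exact: (abs_leD habs rr' h).
Qed.

Lemma ind_profile (k : int) : profile abs q k 1 (fun r => (ind k r)%:C).
Proof.
split=> [r r' rr'|r]; first by rewrite (ind_const rr').
by rewrite normc_def /= expr0n addr0 sqrtr_sqr lecR /ind ger0_norm ?ler0n// lern1 leq_b1.
Qed.

Lemma ind_radial (k : int) : radial abs (fun r => (ind k r)%:C).
Proof. by move=> w r w1; rewrite /ind (absvalM habs) w1 mul1r. Qed.

Lemma sphereE : S = BV 0 `\` BV (-1).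
Proof.
apply/seteqP; split => u; rewrite /setD /mkset (BVE habs) (BVE habs).
  by move=> ->; rewrite expr0z lexx; split => //; rewrite -[1](expr0z Q) (q_le habs).
move=> [h1 h2]; have h3 : nrm u <= Q ^ (-1 + 1) by [].
have := @dist_shell _ _ _ _ _ _ _ uV 0 u (-1).
by rewrite /distV sub0r (normnN habs) addNr expr0z; apply.
Qed.

Lemma sphere_setD (f : 'rV[K]_n -> R[i]) (k : int) : k <= 0 -> flat dV q k (BV 0) f ->
  cintegral mun S f = cintegral mun (BV 0) f - cintegral mun (BV (-1)) f.
Proof.
move=> k0 ff; rewrite sphereE cintegral_setD//.
- exact: us_meas uV 0 0.
- exact: us_meas uV 0 (-1).
- by move=> u; rewrite !(BVE habs) => /le_trans; apply; rewrite (q_le habs).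
- by apply: (bounded_sat_integrable uV _ ff); exact (cball_bounded_sat uV 0 k0).
Qed.

(** If |z| > q^N, write z = rho z' with |z'| = 1: after straightening z' the
    slab meets the balls of radius 1 and 1/q in rectangles.  Otherwise it
    contains the sphere. *)
Lemma band_vol (z : 'rV[K]_n) (N : int) :
  cintegral mun S (fun u => (ind N (dot u z))%:C) =
  (if nrm z <= Q ^ N then 1 - (Q ^+ n)^-1 else Q ^ N / nrm z * (1 - (Q ^+ p)^-1))%:C.
Proof.
have [zN|zN] := boolP (nrm z <= Q ^ N).
  rewrite (@eq_cintegral _ _ _ mun S _ (fun u => 1%:C)); last first.
    move=> u /= u1; rewrite /ind (le_trans (dot_le habs (r := 1) (s := nrm z) _ _ _ _))//.
    - exact: normn_ge0.
    - by rewrite u1.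
    - by rewrite mul1r.
  rewrite (sphere_setD (k := 0))// !cintegral_real -rmorphB; congr (_%:C).
  rewrite !Rintegral_cst; [|exact: us_meas uV 0 _|exact: us_meas uV 0 _].
  by rewrite !(us_vol uV) !mul1r.
have [m zm] : exists m : int, nrm z = Q ^ m.
  case: (normn_val habs z) => // z0; move: zN.
  by rewrite z0 (ltW (qz_gt0 habs _)).
move: zN; rewrite zm (q_le habs) -ltNge => Nm.
have [rho rho0 rhoE] := abs_surj habs m.
pose z' := rho^-1 *: z.
have z'1 : nrm z' = 1 by rewrite (normnZ habs) (absV habs) rhoE zm mulVf// gt_eqF// (qz_gt0 habs).
have NE u : ind N (dot u z) = ind (N - m) (dot z' u).
  rewrite /ind dotZl (absvalM habs) (absV habs) rhoE dotC; congr ((nat_of_bool _)%:R).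
  by rewrite ler_pdivrMl ?(qz_gt0 habs)// -expfzDr ?(q_neq0 habs)// addrC subrK.
rewrite (@eq_cintegral _ _ _ mun S _ (fun u => (ind (N - m) (dot z' u))%:C)); last first.
  by move=> u _; rewrite NE.
have fk k : flat dK q (N - m) (BK k) (fun r => (ind (N - m) r)%:C).
  by move=> r r' _ rr'; rewrite (ind_const rr').
have fV : flat dV q (N - m) (BV 0) (fun u => (ind (N - m) (dot z' u))%:C).
  move=> u v _ uv; congr (_%:C); apply: ind_const; rewrite -dotNr -dotDr -[leRHS]mul1r.
  by apply: (dot_le habs); rewrite ?z'1// ltW// (qz_gt0 habs).
have I0 (j : int) : N - m <= j -> cintegral mun (BV j) (fun u => (ind (N - m) (dot z' u))%:C) =
    ((Q ^ j) ^+ p * Q ^ (N - m))%:C.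
  move=> hj; rewrite (plane_integral habs hmu hmun hj z'1 (fk _)) rmorphM; congr (_ * _).
  rewrite cintegral_real; congr (_%:C); have := ind_integral 0 hj.
  rewrite {2}/ind (abs0 habs) (ltW (qz_gt0 habs _)) mulr1 => <-.
  by apply: eq_Rintegral => y _; rewrite /ind sub0r (absN habs).
rewrite (sphere_setD _ fV); last by lia.
rewrite !I0; try lia; rewrite -rmorphB; congr (_%:C).
rewrite expr0z expr1n expfzDr ?(q_neq0 habs)// -invr_expz mulrC.
rewrite -[Q ^ (-1)]/(Q ^-1) exprVn; ring.
Qed.

End Source.

Section Inversion.
Context {R : realType} {K : topologicalFieldType}.
Variables (abs : K -> R) (q : nat).
Hypothesis habs : normalized_absval abs q.
Local Notation Q := (q%:R : R).
Variable p : nat.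
Local Notation n := p.+1.
Local Notation nrm := (@normn R K abs n).
Variables (mu : {measure set (borelType K) -> \bar R}).
Hypothesis hmu : normalized_haar abs mu.
Variable (mun : {measure set (borelType 'rV[K]_n) -> \bar R}).
Hypothesis hmun : product_haar mu mun.
Local Notation dK := (distK abs : borelType K -> borelType K -> R).
Local Notation dV := (@distV R K abs n : borelType 'rV[K]_n -> borelType 'rV[K]_n -> R).
Local Notation BK := (@cball R _ (borelType K) dK q 0).
Local Notation BV := (@cball R _ (borelType 'rV[K]_n) dV q 0).
Local Notation uK := (ultraK habs hmu).
Local Notation uV := (ultraV habs hmu hmun).

Local Notation S := ([set u : 'rV[K]_n | nrm u = 1] : set (borelType 'rV[K]_n)).
Local Notation ind := (ind abs q).

(** The volume of {u : |u| = 1, |u.z| <= q^N}, see band_vol. *)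
Definition band (z : 'rV[K]_n) (N : int) : R :=
  if nrm z <= Q ^ N then 1 - (Q ^+ n)^-1 else Q ^ N / nrm z * (1 - (Q ^+ p)^-1).

(** The normalized indicator of the ball of radius q^N in K^n, evaluated at z:
    an approximation of the Dirac measure as N tends to -oo. *)
Definition ball_density (z : 'rV[K]_n) (N : int) : R :=
  if nrm z <= Q ^ N then (Q ^+ n) ^ (- N) else 0.

(** Polar coordinates in frequency space, in spectral form.  The difference on
    the left is the spherical integral of the projection of the Dirac measure of
    K onto the frequencies of absolute value q^{-N}; weighted by the radial
    density q^{-pN}, it is (1 - 1/q) times the same projection of the Dirac
    measure of K^n. *)
Lemma polar (z : 'rV[K]_n) (N : int) :
  (Q ^+ p) ^ (- N) * (Q ^ (- N) * band z N - Q ^ (- (N + 1)) * band z (N + 1)) =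
  (1 - Q^-1) * (ball_density z N - ball_density z (N + 1)).
Proof.
have q0 := q_neq0 habs; have Y0 : Q ^+ p != 0 by rewrite expf_neq0.
have X0 : Q ^ N != 0 by rewrite expfz_neq0.
have XS : Q ^ (N + 1) = Q ^ N * Q by rewrite expfzDr// expr1z.
have Z0 : (Q ^ N) ^+ p != 0 by rewrite expf_neq0.
have QN : (Q ^+ p) ^ (- N) = ((Q ^ N) ^+ p)^-1.
  by rewrite -invr_expz (exprzAC Q p%:Z N).
have Qn (M : int) : (Q ^+ n) ^ (- M) = (Q ^ M * (Q ^ M) ^+ p)^-1.
  by rewrite -invr_expz (exprzAC Q n%:Z M) -exprS.
rewrite /band /ball_density !Qn QN -!invr_expz XS exprMn [Q ^+ n]exprS.
have [h1|h1] := boolP (nrm z <= Q ^ N).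
  rewrite (le_trans h1); last first.
    by rewrite ler_peMr ?(ltW (qz_gt0 habs _))// ler1n (ltnW (q_gt1 habs)).
  move: (Q ^+ p) ((Q ^ N) ^+ p) (Q ^ N) Y0 X0 Z0 => Y Z X Y0 X0 Z0.
  by field; rewrite q0 Y0 X0 Z0.
have [m zm] : exists m : int, nrm z = Q ^ m.
  case: (normn_val habs z) => // z0; move: h1.
  by rewrite z0 (ltW (qz_gt0 habs _)).
have [h2|h2] := boolP (nrm z <= Q ^ N * Q).
  have -> : nrm z = Q ^ N * Q.
    rewrite -XS; apply/eqP; rewrite eq_le XS h2 -XS.
    by move: h1; rewrite zm !(q_le habs) -ltNge lezD1.
  move: (Q ^+ p) ((Q ^ N) ^+ p) (Q ^ N) Y0 X0 Z0 => Y Z X Y0 X0 Z0.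
  by field; rewrite q0 Y0 X0 Z0.
rewrite subrr mulr0; apply/eqP; rewrite mulf_eq0; apply/orP; right; apply/eqP.
have W0 : nrm z != 0 by rewrite zm expfz_neq0.
move: (nrm z) (Q ^+ p) (Q ^ N) Y0 X0 W0 => W Y X Y0 X0 W0.
by field; rewrite q0 Y0 X0 W0.
Qed.

Lemma cvg_ball_density z (k : int) : (fun P : nat => ball_density z (k + P%:Z)) @ \oo --> (0 : R).
Proof.
have q0 := q_neq0 habs; have qn0 : Q ^+ n != 0 by rewrite expf_neq0.
have q1 : 1 < Q by rewrite ltr1n (q_gt1 habs).
have qn : 0 < Q ^+ n by rewrite exprn_gt0 ?(q_gt0 habs).
have c : (fun P : nat => (Q ^+ n) ^ (- k) * GRing.exp (Q ^+ n)^-1 P) @ \oo --> (0 : R).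
  rewrite -(mulr0 ((Q ^+ n) ^ (- k))); apply: cvgMr; apply: cvg_expr.
  by rewrite gtr0_norm ?invr_gt0// invf_lt1// exprn_egt1.
apply: (@squeeze_cvgr _ _ _ _ (fun=> 0) _ _ _ _ _ c); last exact: cvg_cst.
apply: nearW => P; rewrite /ball_density.
have -> : (Q ^+ n) ^ (- k) * (Q ^+ n)^-1 ^+ P = (Q ^+ n) ^ (- (k + P%:Z)).
  by rewrite opprD expfzDr// -(exprz_inv _ P%:Z).
by case: ifP => _; rewrite ?lexx ?exprz_ge0 ?ltW.
Qed.

Lemma cvg_sum (I : Type) (s : seq I) (f : I -> nat -> R) (L : I -> R) :
  (forall i, f i @ \oo --> L i) ->
  (fun P => \sum_(i <- s) f i P) @ \oo --> \sum_(i <- s) L i.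
Proof.
move=> fL; elim: s => [|i s IH].
  by rewrite big_nil; under eq_fun do rewrite big_nil; exact: cvg_cst.
rewrite big_cons; under eq_fun do rewrite big_cons; exact: cvgD (fL i) IH.
Qed.

Lemma Dnat_ind_Im (k : int) r :
  complex.Im (Dnat abs q mu p (fun r => (ind k r)%:C) r) = 0.
Proof.
case: p => [//|p']; rewrite /Dnat (DalphaE habs) (@vladimirov_Im R _ (borelType K)) /=.
rewrite (@eq_Rintegral _ _ _ _ _ (fun=> 0)); last by move=> y _; rewrite subrr mulr0.
by rewrite /Rintegral integral0 mulr0.
Qed.

(** spectral_cvg for the indicator of a ball, whose average over the ball of
    radius q^N around r is q^{k - N} ind N r. *)
Lemma Dnat_ind_cvg (k : int) r : (0 < p)%N ->
  (fun P => \sum_(j < P) Q ^ k * ((Q ^+ p) ^ (- (k + j%:Z)) *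
     (Q ^ (- (k + j%:Z)) * ind (k + j%:Z) r -
      Q ^ (- (k + j%:Z + 1)) * ind (k + j%:Z + 1) r))) @ \oo -->
  complex.Re (Dnat abs q mu p (fun r => (ind k r)%:C) r).
Proof.
move=> p0.
have -> : Dnat abs q mu p (fun r => (ind k r)%:C) r =
    Dalpha abs q mu p%:R (fun r => (ind k r)%:C) r by case: (p) p0.
have a0 : 0 < p%:R :> R by rewrite ltr0n.
have tg := increment_tame habs r (ind_profile habs k).
have [r1 r2 r3] := tame_Re tg.
rewrite (DalphaE habs) (@vladimirov_Re R _ (borelType K)).
apply: cvg_trans (spectral_cvg uK a0 r1 r2 r3); apply: near_eq_cvg; apply: nearW => P.
have bE N : (Q `^ (- p%:R)) ^ N = (Q ^+ p) ^ (- N).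
  by rewrite powRN powR_mulrn ?ler0n// -invr_expz expfV.
have av N : k <= N -> ravg dK q mu 1 0 N (fun y => complex.Re ((ind k (r - y))%:C - (ind k r)%:C))
    = Q ^ k * (Q ^ (- N) * ind N r) - ind k r.
  move=> kN; have mB : measurable (BK N) := us_meas uK 0 N.
  rewrite /ravg (_ : Rintegral _ _ _ =
     Rintegral mu (BK N) (fun y => ind k (r - y) - ind k r)); last first.
    by apply: eq_Rintegral => y _; rewrite raddfB.
  rewrite RintegralB//.
  - rewrite (ind_integral habs hmu r kN) Rintegral_cst// (us_vol uK) /= expr1.
    rewrite mulrBr; congr (_ - _); first by rewrite mulrCA !mulrA.
    by rewrite mulrCA -expfzDr ?(q_neq0 habs)// addNr expr0z mulr1.
  - apply: (ball_integrable uK 0 kN) => y z _ yz; apply: (ind_const habs).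
    by rewrite opprB addrC addrA subrK (abs_distC habs).
  - by apply: (ball_integrable uK 0 kN).
apply: eq_bigr => j _; rewrite bE !av; try lia.
by ring.
Qed.

(** For p > 0, Dnat_ind_cvg and polar make the spherical integral a telescoping
    series; for p = 0 there is no operator and band_vol gives the value. *)
Lemma sphere_source (z : 'rV[K]_n) (k : int) :
  cintegral mun S (fun u => Dnat abs q mu p (fun r => (ind k r)%:C) (dot u z)) =
  ((1 - Q^-1) * (Q ^ k * ball_density z k))%:C.
Proof.
set E := Dnat abs q mu p (fun r => (ind k r)%:C).
have [/eqP p0|p0] := boolP (p == 0%N).
  have -> : E = fun r => (ind k r)%:C by rewrite /E p0.
  have Yp : Q ^+ p = 1 by rewrite p0.
  rewrite (band_vol habs hmu hmun) /ball_density exprS Yp invr1 subrr mulr0 mulr1.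
  case: ifP => _; last by rewrite !mulr0.
  by rewrite -expfzDr ?(q_neq0 habs)// subrr expr0z mulr1.
have {}p0 : (0 < p)%N by rewrite lt0n.
have [X zX] := norm_le_pow habs z.
pose l := Num.min (-1) (k - X); have l1 : l <= -1 by rewrite /l; lia.
have dotk u v : nrm (u - v) <= Q ^ l -> abs (dot u z - dot v z) <= Q ^ k.
  move=> uv; rewrite dotC [dot v z]dotC -dotNr -dotDr.
  have -> : Q ^ k = Q ^ X * Q ^ (k - X).
    by rewrite -expfzDr ?(q_neq0 habs)// addrC subrK.
  apply: (dot_le habs (ltW (qz_gt0 habs X)) (ltW (qz_gt0 habs _)) zX).
  by apply: le_trans uv _; rewrite (q_le habs) /l; lia.
have bs := sphere_bounded_sat habs hmu hmun l1; have [s sP] := bounded_sat_net uV bs.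
have [M' EP] := Dnat_profile habs hmu p k 1; have [Ek _] := EP _ (ind_profile habs k).
have Ef : flat dV q l S (fun u => E (dot u z)).
  by move=> u v _ uv; apply: Ek; exact: dotk.
rewrite (net_integral uV sP bs.1 Ef).2.
have bandE N : k <= N -> (Q ^+ n) ^ l * \sum_(u <- s) ind N (dot u z) = band z N.
  move=> kN; apply: (@complexI R); rewrite rmorphM rmorph_sum /=.
  rewrite -(net_integral uV sP bs.1 (f := fun u => (ind N (dot u z))%:C) _).2.
    exact: (band_vol habs hmu hmun).
  move=> u v _ uv; rewrite (@ind_const _ _ _ _ habs N _ (dot v z))//.
  by apply: le_trans (dotk _ _ uv) _; rewrite (q_le habs).
apply: complex_eqP; last first.
  by rewrite Im_realM raddf_sum /= big1 ?mulr0// => u _; exact: Dnat_ind_Im.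
rewrite Re_realM raddf_sum /=.
have C1 : (fun P => (Q ^+ n) ^ l * \sum_(u <- s) \sum_(j < P) Q ^ k *
     ((Q ^+ p) ^ (- (k + j%:Z)) *
     (Q ^ (- (k + j%:Z)) * ind (k + j%:Z) (dot u z) -
      Q ^ (- (k + j%:Z + 1)) * ind (k + j%:Z + 1) (dot u z)))) @ \oo -->
    (Q ^+ n) ^ l * \sum_(u <- s) complex.Re (E (dot u z)).
  by apply: cvgMr; apply: cvg_sum => u; exact: Dnat_ind_cvg.
have SE P : (Q ^+ n) ^ l * \sum_(u <- s) \sum_(j < P) Q ^ k *
     ((Q ^+ p) ^ (- (k + j%:Z)) *
     (Q ^ (- (k + j%:Z)) * ind (k + j%:Z) (dot u z) -
      Q ^ (- (k + j%:Z + 1)) * ind (k + j%:Z + 1) (dot u z)))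
   = (1 - Q^-1) * (Q ^ k * (ball_density z k - ball_density z (k + P%:Z))).
  transitivity (\sum_(j < P) Q ^ k * ((1 - Q^-1) *
      (ball_density z (k + j%:Z) - ball_density z (k + j%:Z + 1)))).
    rewrite exchange_big mulr_sumr; apply: eq_bigr => j _.
    rewrite -polar -!bandE; try lia.
    rewrite -!mulr_sumr sumrB -!mulr_sumr; ring.
  elim: P => [|P IH]; first by rewrite big_ord0 addr0 subrr !mulr0.
  by rewrite big_ord_recr /= IH -addn1 PoszD addrA; ring.
rewrite (funext SE) in C1; apply: (cvg_unique _ C1) => //.
have C2 : (fun P : nat => ball_density z k - ball_density z (k + P%:Z)) @ \oo --> ball_density z k - 0.
  exact: cvgB (cvg_cst _) (cvg_ball_density z k).
by rewrite subr0 in C2; apply: cvgMr; apply: cvgMr.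
Qed.

End Inversion.

(** * The Radon transform of a test function *)

Section RadonTest.
Context {R : realType} {K : topologicalFieldType}.
Variables (abs : K -> R) (q : nat).
Hypothesis habs : normalized_absval abs q.
Local Notation Q := (q%:R : R).
Variable p : nat.
Local Notation n := p.+1.
Local Notation nrm := (@normn R K abs n).
Variables (mu : {measure set (borelType K) -> \bar R}).
Hypothesis hmu : normalized_haar abs mu.
Variable (mun : {measure set (borelType 'rV[K]_n) -> \bar R}).
Hypothesis hmun : product_haar mu mun.
Local Notation dK := (distK abs : borelType K -> borelType K -> R).
Local Notation dV := (@distV R K abs n : borelType 'rV[K]_n -> borelType 'rV[K]_n -> R).
Local Notation BK := (@cball R _ (borelType K) dK q 0).
Local Notation BV := (@cball R _ (borelType 'rV[K]_n) dV q 0).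
Local Notation uK := (ultraK habs hmu).
Local Notation uV := (ultraV habs hmu hmun).

Implicit Types (phi : 'rV[K]_n -> R[i]).

Definition at_level (k : int) phi :=
  forall x y, nrm (x - y) <= Q ^ k -> phi x = phi y.

(** Compactness bounds the support: the balls around 0 cover it. *)
Lemma test_level phi : test_function abs q phi ->
  exists k N : int, [/\ k <= N, at_level k phi &
    forall x, phi x != 0 -> nrm x <= Q ^ N].
Proof.
move=> [[l lP] cpt].
have [N0 NP] : exists N : nat, forall x, phi x != 0 -> nrm x <= Q ^ N.
  have : cover_compact (closure [set x | phi x != 0]) by rewrite -compact_cover.
  move=> /(_ nat setT (fun i : nat => [set x | @distV R K abs n 0 x <= Q ^ i])).
  case=> [i _|x _|D _ cov].
  - exact: (ballV_open habs).
  - have [i xi] := dist_bounded uV 0 x; exists i => //.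
  exists (\max_(i <- finmap.enum_fset D) i)%N => x x0.
  have [i iD /=] := cov x (@subset_closure _ [set x | phi x != 0] x x0).
  rewrite /distV sub0r (normnN habs) => /le_trans; apply; rewrite (q_le habs) lez_nat.
  by rewrite (big_rem i)//= leq_maxl.
exists (Num.min (- l) N0), (N0%:Z); split => //; first by lia.
move=> x y xy; rewrite -[x](subrK y) addrC; apply: lP.
by apply: le_trans xy _; rewrite (q_le habs); lia.
Qed.

Section Level.
Variables (phi : 'rV[K]_n -> R[i]) (k N : int) (s : seq 'rV[K]_n).
Hypothesis kN : k <= N.
Hypothesis phik : at_level k phi.
Hypothesis phiN : forall x, phi x != 0 -> nrm x <= Q ^ N.
Hypothesis sP : net dV q k (BV N) s.

Lemma test_decomp x : phi x = \sum_(a <- s) phi a * (if nrm (x - a) <= Q ^ k then 1 else 0).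
Proof.
have [us_ sD sep cov] := sP.
have [xN|xN] := boolP (nrm x <= Q ^ N); last first.
  have -> : phi x = 0 by apply: contraNeq xN; exact: phiN.
  rewrite big_seq big1// => a sa; case: ifP => h; last by rewrite mulr0.
  have := sD a sa; rewrite (BVE habs) => aN; case/negP: xN.
  rewrite -(subrK a x); apply: le_trans (normn_ultra habs _ _) _.
  by rewrite ge_max aN andbT; apply: le_trans h _; rewrite (q_le habs).
have [a sa ax] : exists2 a, a \in s & dV a x <= Q ^ k by apply: cov; rewrite (BVE habs).
rewrite (bigD1_seq a)//= big_seq_cond big1 ?addr0.
  have -> : nrm (x - a) <= Q ^ k by move: ax; rewrite (us_sym uV).
  by rewrite mulr1; apply: phik; rewrite -opprB (normnN habs).
move=> b /andP[sb ba]; case: ifP => h; last by rewrite mulr0.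
case/eqP: ba; apply: sep => //; apply: (dist_trans uV (y := x)).
  by rewrite (us_sym uV).
by rewrite (us_sym uV).
Qed.

Lemma test_integral (g : 'rV[K]_n -> R[i]) (j : int) : j <= k ->
  flat dV q j (BV N) g ->
  cintegral mun setT (fun x => phi x * g x) =
  \sum_(a <- s) phi a * cintegral mun (@cball R _ (borelType 'rV[K]_n) dV q a k) g.
Proof.
move=> jk gf; have [us_ sD sep cov] := sP.
have jN : j <= N := le_trans jk kN.
have bs : bounded_sat dV q j (BV N) by exact (cball_bounded_sat uV 0 jN).
transitivity (cintegral mun (BV N) (fun x => phi x * g x)).
  have -> : BV N = setT `&` [set x | nrm x <= Q ^ N].
    by rewrite setTI; apply/funext => x; rewrite (BVE habs).
  rewrite -cintegral_if; apply: eq_cintegral => x _; case: ifP => //.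
  by move=> /negbT xN; rewrite (_ : phi x = 0) ?mul0r//; apply: contraNeq xN; exact: phiN.
rewrite (@eq_cintegral _ _ _ mun (BV N) _ (fun x => \sum_(a <- s) phi a *
    (if nrm (x - a) <= Q ^ k then g x else 0))); last first.
  move=> x _; rewrite {1}test_decomp mulr_suml; apply: eq_bigr => a _.
  by case: ifP => _; rewrite ?mulr1// mulr0 mul0r.
have fl a : flat dV q j (BV N) (fun x => if nrm (x - a) <= Q ^ k then g x else 0).
  move=> x y xN xy; rewrite (gf x y)//; congr (if _ then _ else _).
  have xyk : nrm (x - y) <= Q ^ k by apply: le_trans xy _; rewrite (q_le habs).
  apply/idP/idP => h.
    rewrite -(subrKA x) addrC; apply: le_trans (normn_ultra habs _ _) _.
    by rewrite ge_max h -opprB (normnN habs).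
  by rewrite -(subrKA y); apply: le_trans (normn_ultra habs _ _) _; rewrite ge_max h xyk.
have mB : measurable (BV N) by exact: us_meas uV 0 N.
have [|_ ->] := @cintegral_sum _ _ _ mun _ s (fun a x => phi a *
    (if nrm (x - a) <= Q ^ k then g x else 0)) (BV N) mB.
  by move=> a; apply: cintegrableZ mB _; exact (bounded_sat_integrable uV bs (fl a)).
rewrite big_seq [RHS]big_seq; apply: eq_bigr => a sa.
rewrite (cintegralZ _ mB (bounded_sat_integrable uV bs (fl a))); congr (_ * _).
rewrite cintegral_if; congr cintegral; apply/seteqP; split => x /=.
  by move=> [_ h]; rewrite /cball /= /distV -opprB (normnN habs).
move=> h; split; last by rewrite -opprB (normnN habs).
exact (cball_saturated uV kN (sD a sa) h).
Qed.

End Level.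

Lemma ball_translate (a : 'rV[K]_n) (j k : int) (g : 'rV[K]_n -> R[i]) : j <= k ->
  flat dV q j setT g ->
  cintegral mun (@cball R _ (borelType 'rV[K]_n) dV q a k) g =
  cintegral mun (BV k) (fun y => g (a + y)).
Proof.
move=> jk gf; apply/esym.
have b1 : bounded_sat dV q j (BV k) by exact (cball_bounded_sat uV 0 jk).
have b2 := cball_bounded_sat uV a jk.
apply: (isometry_integral uV (phi := fun y => a + y) jk (fun _ => id) b1.1 b2.1).
- by move=> x y _ ; exact: gf.
- by move=> x y; rewrite /distV opprD addrACA subrr add0r.
- by move=> x; rewrite (BVE habs) /cball /= /distV opprD addrA subrr sub0r (normnN habs).
- move=> y ay; exists (y - a); last by rewrite addrC subrK.
  by rewrite (BVE habs) -opprB (normnN habs).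
Qed.

End RadonTest.

Section RadonFormula.
Context {R : realType} {K : topologicalFieldType}.
Variables (abs : K -> R) (q : nat).
Hypothesis habs : normalized_absval abs q.
Local Notation Q := (q%:R : R).
Variable p : nat.
Local Notation n := p.+1.
Local Notation nrm := (@normn R K abs n).
Variables (mu : {measure set (borelType K) -> \bar R}).
Hypothesis hmu : normalized_haar abs mu.
Variable (mun : {measure set (borelType 'rV[K]_n) -> \bar R}).
Hypothesis hmun : product_haar mu mun.
Local Notation dK := (distK abs : borelType K -> borelType K -> R).
Local Notation dV := (@distV R K abs n : borelType 'rV[K]_n -> borelType 'rV[K]_n -> R).
Local Notation BK := (@cball R _ (borelType K) dK q 0).
Local Notation BV := (@cball R _ (borelType 'rV[K]_n) dV q 0).
Local Notation uK := (ultraK habs hmu).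
Local Notation uV := (ultraV habs hmu hmun).

Local Notation ind := (ind abs q).
Local Notation ballK r j := (@cball R _ (borelType K) dK q r j).

(** A continuous function whose averages over the small balls around r are all
    equal to A has value A at r; this pins down a Radon transform that the
    disintegration identity alone determines almost everywhere. *)
Lemma average_continuous (g : K -> R[i]) (A : R[i]) (r : K) (k : int) :
  continuous (g : K -> R[i]^o) ->
  (forall j : int, j <= k -> cintegral mu (ballK r j) g = (Q ^ j)%:C * A) ->
  g r = A.
Proof.
move=> gc gA.
have near_g (e : R) : 0 < e -> exists2 j : int, j <= k &
    forall s, ballK r j s -> `|g r - g s| <= e%:C.
  move=> e0; have e0' : 0 < e%:C :> R[i] by rewrite -[0]/(0%:C) ltcR.
  have /cvgrPdist_le/(_ _ e0') := gc r.
  move=> /(absval_nbhs habs)[d d0 dP].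
  have [j [jk jd]] : exists j : int, j <= k /\ Q ^ j < d.
    (* A radius q^j below d. *)
    have [m mP] : exists m : nat, d^-1 < Q ^ m.
      exists (Num.bound d^-1).
      have h : d^-1 < (Num.bound d^-1)%:R by apply: archi_boundP; rewrite invr_ge0 ltW.
      apply: lt_le_trans h _; rewrite -exprnP -natrX ler_nat ltnW//.
      exact: ltn_expl (q_gt1 habs).
    exists (Num.min k (- m%:Z)); split; first by lia.
    apply: (@le_lt_trans _ _ (Q ^ (- m%:Z))); first by rewrite (q_le habs); lia.
    by rewrite -invr_expz invf_plt ?posrE// (qz_gt0 habs).
  exists j => // s rs; apply: dP => /=; apply: le_lt_trans jd.
  by rewrite (abs_distC habs).
have real (f : K -> R) (a : R) : (forall e : R, 0 < e -> exists2 j : int, j <= k &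
      forall s, ballK r j s -> `|f r - f s| <= e) ->
    measurable_fun (setT : set (borelType K)) f ->
    (forall j : int, j <= k -> Rintegral mu (ballK r j) f = Q ^ j * a) -> f r = a.
  move=> fn mf fa; apply/eqP; rewrite -subr_eq0 -normr_le0; apply/ler_addgt0Pl => e e0.
  rewrite addr0; have [j jk jP] := fn e e0.
  have mB : measurable (ballK r j) := us_meas uK r j.
  have fin : (mu (ballK r j) < +oo)%E by rewrite (us_vol uK) ltry.
  have fi : mu.-integrable (ballK r j) (EFin \o f).
    apply: measurable_bounded_integrable => //; first exact: measurable_funTS.
    exists (`|f r| + e); split; first exact: num_real.
    move=> M' hM s rs; apply: le_trans (ltW hM) => /=.
    rewrite -(subKr (f r) (f s)); apply: le_trans (ler_normB _ _) _.
    by rewrite lerD2l; exact: jP.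
  have ci (c : R) : mu.-integrable (ballK r j) (EFin \o (fun=> c)).
    apply: measurable_bounded_integrable => //.
    by exists `|c|; split; [exact: num_real | move=> M' hM s _; exact: ltW].
  have : Rintegral mu (ballK r j) (fun s => f r - f s) = Q ^ j * (f r - a).
    rewrite RintegralB// fa// Rintegral_cst// (us_vol uK) expr1 /= mulrBr.
    by rewrite mulrC.
  move=> E; have : `|Q ^ j * (f r - a)| <= Q ^ j * e.
    rewrite -E; apply: le_trans (le_normr_Rintegral mB _) _.
      by apply: eq_integrable (integrableB mB (ci (f r)) fi).
    have -> : Q ^ j * e = Rintegral mu (ballK r j) (fun=> e).
      by rewrite Rintegral_cst// (us_vol uK) expr1 mulrC.
    apply: le_Rintegral => //.
    apply: integrable_norm; by apply: eq_integrable (integrableB mB (ci (f r)) fi).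
  by rewrite normrM (gtr0_norm (qz_gt0 habs j)) ler_pM2l// (qz_gt0 habs).
have mf (f : K -> R) : (forall s (e : R), 0 < e -> nbhs s (fun s' => `|f s - f s'| <= e)) ->
    measurable_fun (setT : set (borelType K)) f.
  move=> fc; have fcont : continuous f.
    by move=> s; apply/cvgrPdist_le => e e0; exact: fc.
  move/continuousP : fcont => cf mT.
  apply: (measurability _ (RGenOpens.measurableE R)) => //.
  move=> _ [_ [a [b ->] <-]]; rewrite setTI; apply: sub_sigma_algebra.
  by apply: cf; exact: interval_open.
have gn s (e : R) : 0 < e -> nbhs s (fun s' => `|g s - g s'| <= e%:C).
  move=> e0; have e0' : 0 < e%:C :> R[i] by rewrite -[0]/(0%:C) ltcR.
  by have /cvgrPdist_le/(_ _ e0') := gc s.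
have nRe z w (e : R) : `|z - w| <= e%:C -> `|complex.Re z - complex.Re w| <= e.
  move=> h; rewrite -raddfB -lecR; apply: le_trans h; exact: normc_ge_Re.
have nIm z w (e : R) : `|z - w| <= e%:C -> `|complex.Im z - complex.Im w| <= e.
  move=> h; rewrite -raddfB -lecR; apply: le_trans h; exact: normc_ge_Im.
apply: complex_eqP.
  apply: (real (fun s => complex.Re (g s))).
  - by move=> e /near_g[j jk jP]; exists j => // s /jP/nRe.
  - apply: mf => s e e0; apply: filterS (gn s e e0) => s'; exact: nRe.
  - by move=> j jk; rewrite -[LHS]/(complex.Re (cintegral mu (ballK r j) g)) gA// Re_realM.
apply: (real (fun s => complex.Im (g s))).
- by move=> e /near_g[j jk jP]; exists j => // s /jP/nIm.
- apply: mf => s e e0; apply: filterS (gn s e e0) => s'; exact: nIm.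
- by move=> j jk; rewrite -[LHS]/(complex.Im (cintegral mu (ballK r j) g)) gA// Im_realM.
Qed.

Lemma subrBB (x y r : K) : x - r - (y - r) = x - y.
Proof. by rewrite opprB addrA subrK. Qed.

(** After a translation by a this is the plane wave u.y with the indicator of a
    ball as profile. *)
Lemma slab_integral (u a : 'rV[K]_n) (j k : int) (r : K) : j <= k -> nrm u = 1 ->
  cintegral mun (@cball R _ (borelType 'rV[K]_n) dV q a k)
    (fun x => (ind j (dot u x - r))%:C) =
  ((Q ^ k) ^+ p * (Q ^ j * ind k (r - dot u a)))%:C.
Proof.
move=> jk u1; rewrite (ball_translate habs hmu hmun a jk); last first.
  move=> x y _ xy; congr (_%:C); apply: (ind_const habs).
  rewrite subrBB -dotNr -dotDr -[leRHS]mul1r.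
  by apply: (dot_le habs); rewrite ?u1// ltW// (qz_gt0 habs).
set rho := r - dot u a.
rewrite (@eq_cintegral _ _ _ mun _ _ (fun y => (ind j (dot u y - rho))%:C)); last first.
  by move=> y _; rewrite dotDr /rho opprB addrA [dot u a + _]addrC.
rewrite (plane_integral habs hmu hmun (g := fun t => (ind j (t - rho))%:C) jk u1); last first.
  move=> x y _ xy; congr (_%:C); apply: (ind_const habs).
  by rewrite subrBB.
rewrite rmorphM; congr (_ * _); rewrite cintegral_real -(ind_integral habs hmu rho jk).
by congr (_%:C); apply: eq_Rintegral => y _; rewrite /ind (abs_distC habs).
Qed.

Section HyperplaneFormula.
Variables (omega : 'rV[K]_n -> K -> {measure set (borelType 'rV[K]_n) -> \bar R}).
Hypothesis homega : hyperplane_measures abs q mu mun omega.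
Variables (phi : 'rV[K]_n -> R[i]) (k N : int) (s : seq 'rV[K]_n).
Hypothesis hphi : test_function abs q phi.
Hypothesis kN : k <= N.
Hypothesis phik : at_level abs q k phi.
Hypothesis phiN : forall x, phi x != 0 -> nrm x <= Q ^ N.
Hypothesis sP : net dV q k (BV N) s.

Lemma slab_test_function u r (j : int) : j <= k -> nrm u = 1 ->
  test_function abs q (fun x => phi x * (ind j (dot u x - r))%:C).
Proof.
move=> jk u1; split.
  exists (- j) => x x'; rewrite opprK => xj.
  congr (_ * _).
    by apply: phik; rewrite addrAC subrr add0r; apply: le_trans xj _; rewrite (q_le habs).
  congr (_%:C); apply: (ind_const habs); rewrite dotDr subrBB addrAC subrr add0r.
  by rewrite -[leRHS]mul1r; apply: (dot_le habs); rewrite ?u1// ltW// (qz_gt0 habs).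
apply: (subclosed_compact _ hphi.2); first exact: closed_closure.
apply: closure_subset => x /=; apply: contra_neq => ->; exact: mul0r.
Qed.

(** The disintegration identity for phi times the indicator of the slab
    |u.x - r| <= q^j yields the average of the Radon transform over the ball of
    radius q^j around r.  It does not depend on j <= k because phi is constant
    at scale q^k, and continuity gives the value at r. *)
Lemma hyperplane_radon u r : nrm u = 1 ->
  cintegral (omega u r) (hyperplane u r) phi =
  \sum_(a <- s) phi a * ((Q ^ k) ^+ p)%:C * (ind k (r - dot u a))%:C.
Proof.
move=> u1.
have u0 : u != 0.
  by apply/eqP => uz; move: u1; rewrite uz (normn0 habs) => /esym/eqP; rewrite oner_eq0.
have [_ hu] := homega u0.
pose g t := cintegral (omega u t) (hyperplane u t) phi.
apply: (@average_continuous g _ r k); first exact: (hu phi hphi).1.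
move=> j jk.
have [_ E] := hu _ (slab_test_function r jk u1).
transitivity (cintegral mu setT (fun t => if abs (t - r) <= Q ^ j then g t else 0)).
  rewrite cintegral_if setTI; congr cintegral; apply/funext => t.
  by rewrite /cball /= /distK (abs_distC habs).
transitivity (cintegral mun setT (fun x => phi x * (ind j (dot u x - r))%:C)).
  rewrite -E; apply: eq_cintegral => t _; case: ifP => h.
    apply: eq_cintegral => x /= ->; by rewrite /ind h mulr1.
  rewrite -[LHS](cintegral0 (omega u t) (hyperplane u t)).
  by apply: eq_cintegral => x /= ->; rewrite /ind h mulr0.
rewrite (test_integral habs hmu hmun kN phik phiN sP jk).
  rewrite mulr_sumr; apply: eq_bigr => a _; rewrite slab_integral//.
  by rewrite (rmorphM (real_complex R)) (rmorphM (real_complex R)) /=; ring.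
move=> x y _ xy; congr (_%:C); apply: (ind_const habs).
rewrite subrBB -dotNr -dotDr -[leRHS]mul1r.
by apply: (dot_le habs); rewrite ?u1// ltW// (qz_gt0 habs).
Qed.

End HyperplaneFormula.

Section FourierFormula.
Variable chi : K -> R[i].
Hypothesis hchi : rank0_character abs q chi.
Variables (phi : 'rV[K]_n -> R[i]) (k N : int) (s : seq 'rV[K]_n).
Hypothesis kN : k <= N.
Hypothesis phik : at_level abs q k phi.
Hypothesis phiN : forall x, phi x != 0 -> nrm x <= Q ^ N.
Hypothesis sP : net dV q k (BV N) s.

Lemma chi_const x y : abs (x - y) <= 1 -> chi x = chi y.
Proof.
have [cD _ c1 _] := hchi => /c1 h.
by rewrite -[x](subrK y) cD h mul1r.
Qed.

Lemma chi_flat (c : K) : exists2 l : int, l <= k & l <= - k /\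
  forall x y, abs (x - y) <= Q ^ l -> chi (c * x) = chi (c * y).
Proof.
have [m cm] : exists m : int, abs c <= Q ^ m.
  case: (abs_val habs c) => [->|[m ->]]; last by exists m.
  by exists 0; rewrite expr0z ler01.
exists (Num.min k (Num.min (- k) (- m))); first by lia.
split; first by lia.
move=> x y xy; apply: chi_const; rewrite -mulrBr (absvalM habs).
rewrite -[1](_ : Q ^ m * Q ^ (- m) = 1); last first.
  by rewrite -expfzDr ?(q_neq0 habs)// subrr expr0z.
apply: ler_pM; rewrite ?(absval_ge0 habs)//.
by apply: le_trans xy _; rewrite (q_le habs); lia.
Qed.

(** Orthogonality: if c is large the ball contains some y1 with chi (c y1) <> 1,
    and the translation by y1 multiplies the integral by chi (c y1). *)
Lemma character_integral (c : K) (j l : int) : l <= j ->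
  (forall x y, abs (x - y) <= Q ^ l -> chi (c * x) = chi (c * y)) ->
  cintegral mu (BK j) (fun y => chi (c * y)) = (Q ^ j * ind (- j) c)%:C.
Proof.
move=> lj cl; have [cD cN c1 [x0 x0q chi0]] := hchi.
have mB : measurable (BK j) := us_meas uK 0 j.
have [h|h] := boolP (abs c <= Q ^ (- j)).
  rewrite (@eq_cintegral _ _ _ mu _ _ (fun=> 1%:C)); last first.
    move=> y; rewrite (BKE habs) => yj; apply: c1; rewrite (absvalM habs).
    rewrite -[1](_ : Q ^ (- j) * Q ^ j = 1); last first.
      by rewrite -expfzDr ?(q_neq0 habs)// addNr expr0z.
    by apply: ler_pM; rewrite ?(absval_ge0 habs).
  by rewrite cintegral_real Rintegral_cst// (us_vol uK) expr1 mul1r /ind h mulr1.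
rewrite /ind (negbTE h) mulr0.
have c0 : c != 0 by apply: contraNneq h => ->; rewrite (abs0 habs) ltW// (qz_gt0 habs).
have y1j : abs (c^-1 * x0) <= Q ^ j.
  have [m cm] := abs_neq0 habs c0; move: h; rewrite cm (q_le habs) -ltNge => h.
  rewrite (absvalM habs) (absV habs) x0q cm invr_expz -[X in _ * X]expr1z.
  by rewrite -expfzDr ?(q_neq0 habs)// (q_le habs); lia.
have bs : bounded_sat dK q l (BK j) by exact (cball_bounded_sat uK 0 lj).
have fl : flat dK q l (BK j) (fun y => chi (c * y)) by move=> x y _; exact: cl.
have E : cintegral mu (BK j) (fun y => chi (c * y)) =
    chi x0 * cintegral mu (BK j) (fun y => chi (c * y)).
  rewrite -(cintegralZ _ mB (bounded_sat_integrable uK bs fl)).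
  rewrite -[LHS](isometry_integral uK (phi := fun y => c^-1 * x0 + y) lj (fun _ => id) bs.1 bs.1 fl).
  - apply: eq_cintegral => y _ /=; rewrite mulrDr cD mulrA divff// mul1r//.
  - by move=> x y; rewrite /distK opprD addrACA subrr add0r.
  - by move=> y; rewrite !(BKE habs) => yj; exact: (abs_leD habs y1j yj).
  - move=> y; rewrite (BKE habs) => yj; exists (y - c^-1 * x0); last by rewrite addrC subrK.
    by rewrite (BKE habs); exact: (abs_leB habs yj y1j).
have : (1 - chi x0) * cintegral mu (BK j) (fun y => chi (c * y)) = 0.
  by rewrite mulrBl mul1r -E subrr.
by move/eqP; rewrite mulf_eq0 subr_eq0 eq_sym (negbTE chi0) => /eqP.
Qed.

Lemma fourier_test (u : 'rV[K]_n) (c : K) : nrm u = 1 ->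
  fourier mun chi phi (c *: u) =
  \sum_(a <- s) phi a * (chi (c * dot u a) * ((Q ^ k) ^+ p * (Q ^ k * ind (- k) c))%:C).
Proof.
move=> u1; have [cD _ _ _] := hchi; have [l lk [_ cl]] := chi_flat c.
have fl (D : set 'rV[K]_n) : flat dV q l D (fun x => chi (c * dot u x)).
  move=> x y _ xy; apply: cl; rewrite -dotNr -dotDr -[leRHS]mul1r.
  by apply: (dot_le habs); rewrite ?u1// ltW// (qz_gt0 habs).
rewrite /fourier (@eq_cintegral _ _ _ mun _ _ (fun x => phi x * chi (c * dot u x))); last first.
  by move=> x _; rewrite mulrC dotC dotZl.
rewrite (test_integral habs hmu hmun kN phik phiN sP lk (fl _)).
apply: eq_bigr => a _; congr (_ * _).
rewrite (ball_translate habs hmu hmun a lk (fl _)).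
rewrite (@eq_cintegral _ _ _ mun _ _ (fun y => chi (c * dot u a) * chi (c * dot u y))); last first.
  by move=> y _; rewrite dotDr mulrDr cD.
have bs : bounded_sat dV q l (BV k) by exact (cball_bounded_sat uV 0 lk).
rewrite (cintegralZ _ (bounded_sat_measurable uV bs) (bounded_sat_integrable uV bs (fl _))).
congr (_ * _).
rewrite (plane_integral habs hmu hmun (g := fun y => chi (c * y)) lk u1); last first.
  by move=> x y _; exact: cl.
by rewrite (character_integral lk cl) -rmorphM.
Qed.

(** Two orthogonality relations: the Fourier transform of a ball is supported in
    the dual ball, and the inverse transform over the dual ball restores the
    indicator. *)
Lemma fourier_radon (u : 'rV[K]_n) r : nrm u = 1 ->
  cintegral mu setT (fun c => chi (- (c * r)) * fourier mun chi phi (c *: u)) =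
  \sum_(a <- s) phi a * ((Q ^ k) ^+ p)%:C * (ind k (r - dot u a))%:C.
Proof.
move=> u1; have [cD _ _ _] := hchi.
pose h a c := (phi a * ((Q ^ k) ^+ p * Q ^ k)%:C) * chi ((dot u a - r) * c).
rewrite (@eq_cintegral _ _ _ mu _ _ (fun c => if abs c <= Q ^ (- k) then
    \sum_(a <- s) h a c else 0)); last first.
  move=> c _; rewrite (fourier_test c u1) mulr_sumr /ind.
  case: ifP => ck; last first.
    by rewrite big1// => a _; rewrite !mulr0.
  apply: eq_bigr => a _; rewrite /h mulr1 -!mulrA mulrCA; congr (_ * _).
  rewrite mulrA -cD mulrC; congr (_ * chi _); rewrite mulrBl [X in - X + _]mulrC addrC.
  by congr (_ - _); exact: mulrC.
rewrite cintegral_if.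
have -> : setT `&` [set c | abs c <= Q ^ (- k)] = BK (- k) :> set K.
  by rewrite setTI; apply/funext => c; rewrite (BKE habs).
have mB : measurable (BK (- k)) := us_meas uK 0 (- k).
have hi a : cintegrable mu (BK (- k)) (fun c => chi ((dot u a - r) * c)).
  have [l _ [lk cl]] := chi_flat (dot u a - r).
  have bs : bounded_sat dK q l (BK (- k)) by exact (cball_bounded_sat uK 0 lk).
  by apply: (bounded_sat_integrable uK bs) => x y _; exact: cl.
have [|_ ->] := @cintegral_sum _ _ _ mu _ s h (BK (- k)) mB.
  by move=> a; exact: cintegrableZ mB (hi a).
apply: eq_bigr => a _; rewrite (cintegralZ _ mB (hi a)).
have [l _ [lk cl]] := chi_flat (dot u a - r).
rewrite (character_integral lk cl) opprK -!mulrA -rmorphM -[in RHS]rmorphM; congr (_ * _%:C).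
rewrite -mulrA [Q ^ k * _]mulrA -expfzDr ?(q_neq0 habs)// subrr expr0z mul1r.
by rewrite /ind (abs_distC habs).
Qed.

End FourierFormula.

End RadonFormula.

(** * The solution of the Cauchy problem *)

Section SourceFamily.
Context {R : realType} {K : topologicalFieldType}.
Variables (abs : K -> R) (q : nat).
Hypothesis habs : normalized_absval abs q.
Local Notation Q := (q%:R : R).
Variable p : nat.
Local Notation n := p.+1.
Local Notation nrm := (@normn R K abs n).
Variables (mu : {measure set (borelType K) -> \bar R}).
Hypothesis hmu : normalized_haar abs mu.
Variable (mun : {measure set (borelType 'rV[K]_n) -> \bar R}).
Hypothesis hmun : product_haar mu mun.
Local Notation dK := (distK abs : borelType K -> borelType K -> R).
Local Notation dV := (@distV R K abs n : borelType 'rV[K]_n -> borelType 'rV[K]_n -> R).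
Local Notation BK := (@cball R _ (borelType K) dK q 0).
Local Notation BV := (@cball R _ (borelType 'rV[K]_n) dV q 0).
Local Notation uK := (ultraK habs hmu).
Local Notation uV := (ultraV habs hmu hmun).

Local Notation S := ([set u : 'rV[K]_n | nrm u = 1] : set (borelType 'rV[K]_n)).
Local Notation ind := (ind abs q).
Variables (k N : int) (s : seq 'rV[K]_n).
Hypothesis sN : forall a, a \in s -> nrm a <= Q ^ N.

(** With c a = phi a q^{kp} and e the indicator of the ball of radius q^k this is
    the Radon transform of phi in the direction u. *)
Definition family (c : 'rV[K]_n -> R[i]) (e : K -> R[i]) (u : 'rV[K]_n) (r : K) : R[i] :=
  \sum_(a <- s) c a * e (r - dot u a).

Lemma family_profile c M e : profile abs q k M e ->
  exists M', forall u, profile abs q k M' (family c e u).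
Proof.
move=> [ek eM].
exists (\sum_(a <- s) (`|complex.Re (c a)| + `|complex.Im (c a)|) * M) => u; split.
  by move=> r r' rr'; apply: eq_bigr => a _; congr (_ * _); apply: ek; rewrite subrBB.
move=> r; apply: le_trans (ler_norm_sum _ _ _) _; rewrite rmorph_sum /=.
apply: ler_sum => a _; rewrite normrM rmorphM; apply: ler_pM => //.
exact: normc_le_ReIm.
Qed.

Lemma family_level c M e : profile abs q k M e -> forall u u' r, nrm u = 1 ->
  nrm (u - u') <= Q ^ (k - N) -> family c e u r = family c e u' r.
Proof.
move=> [ek _] u u' r _ uu'; rewrite /family big_seq [RHS]big_seq.
apply: eq_bigr => a sa; congr (_ * _); apply: ek.
rewrite opprB addrC addrA subrK (abs_distC habs) dotC [dot u' a]dotC -dotNr -dotDr.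
have -> : Q ^ k = Q ^ N * Q ^ (k - N).
  by rewrite -expfzDr ?(q_neq0 habs)// addrC subrK.
by apply: (dot_le habs); rewrite ?(sN sa)// ltW// (qz_gt0 habs).
Qed.

Lemma family_radial c e : radial abs e -> forall w u r, abs w = 1 ->
  family c e (w *: u) (w * r) = family c e u r.
Proof.
by move=> er w u r w1; apply: eq_bigr => a _; rewrite dotZl -mulrBr er.
Qed.

Lemma family_Dnat c M e m u b t : profile abs q k M e ->
  Dnat abs q mu m (fun t' => family c e u (t' + b)) t =
  family c (Dnat abs q mu m e) u (t + b).
Proof.
move=> eP; rewrite (Dnat_shift habs mu m (family c e u)) /family.
rewrite (Dnat_sum habs hmu s c m (f := fun a r => e (r - dot u a)) (k := k) (M := M)).
  by apply: eq_bigr => a _; rewrite (Dnat_shift habs).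
move=> a; split=> [r r' rr'|r]; last exact: eP.2.
by apply: eP.1; rewrite subrBB.
Qed.

(** The normalizing constant is absorbed in the coefficients, so that the
    results on superpositions apply to F1 and F2 themselves. *)
Lemma superpose_scale c M e (C : R[i]) t x : profile abs q k M e ->
  C * cintegral mun S (fun u => family c e u (t + dot u x)) =
  superpose abs mun (family (fun a => C * c a) e) t x.
Proof.
move=> eP; have [M' HP] := family_profile c eP.
have [X xX] := norm_le_pow habs x.
have [l l1 lP] := sphere_level habs HP (family_level c eP) X.
have bs := sphere_bounded_sat habs hmu hmun l1.
rewrite -cintegralZ; last 2 first.
- exact (bounded_sat_measurable uV bs).
- by apply: (bounded_sat_integrable uV bs) => u v u1 uv; exact: lP.
apply: eq_cintegral => u _; rewrite /family mulr_sumr.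
by apply: eq_bigr => a _; rewrite mulrA.
Qed.

Lemma superpose_initial c M x : let E := Dnat abs q mu p (fun r => (ind k r)%:C) in
  profile abs q k M E ->
  superpose abs mun (family c E) 0 x =
  \sum_(a <- s) c a * ((1 - Q^-1) * (Q ^ k * ball_density abs q (x - a) k))%:C.
Proof.
move=> E EP; rewrite /superpose /family.
rewrite (@eq_cintegral _ _ _ mun S _
  (fun u => \sum_(a <- s) c a * E (dot u (x - a)))); last first.
  by move=> u _; apply: eq_bigr => a _; rewrite add0r dotDr dotNr.
have Ei a : cintegrable mun S (fun u => E (dot u (x - a))).
  have [X xX] := norm_le_pow habs (x - a).
  have [||l l1 lP] := @sphere_level _ _ _ _ habs p k k M (fun=> E) _ _ X.
  - by [].
  - by [].
  apply: (bounded_sat_integrable uV (sphere_bounded_sat habs hmu hmun l1)) => u v u1 uv.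
  by have := lP u v u1 uv 0 (x - a) xX; rewrite !add0r.
have mS : measurable S := bounded_sat_measurable uV (sphere_bounded_sat habs hmu hmun (lexx _)).
have [|_ ->] := @cintegral_sum _ _ _ mun _ s (fun a u => c a * E (dot u (x - a))) S mS.
  by move=> a; exact: cintegrableZ mS (Ei a).
by apply: eq_bigr => a _; rewrite (cintegralZ _ mS (Ei a)) (sphere_source habs hmu hmun).
Qed.

End SourceFamily.

Theorem theorem1 (R : realType) (K : topologicalFieldType)
    (hK : nonarch_local_field K)
    (abs : K -> R) (q : nat) (habs : normalized_absval abs q)
    (mu : {measure set (borelType K) -> \bar R}) (hmu : normalized_haar abs mu)
    (chi : K -> R[i]) (hchi : rank0_character abs q chi)
    (n : nat) (hn : (1 <= n)%N)
    (mun : {measure set (borelType 'rV[K]_n) -> \bar R})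
    (hmun : product_haar mu mun)
    (omega : 'rV[K]_n -> K -> {measure set (borelType 'rV[K]_n) -> \bar R})
    (homega : (2 <= n)%N -> hyperplane_measures abs q mu mun omega)
    (alpha : R) (halpha : 0 < alpha)
    (phi : 'rV[K]_n -> R[i]) (hphi : test_function abs q phi) :
  let Gamma (t : K) (x u : 'rV[K]_n) : R[i] :=
    radon mu mun chi omega phi u (t + dot u x) in
  let sphere : set 'rV[K]_n := [set u | normn abs u = 1] in
  let F1 (t : K) (x : 'rV[K]_n) : R[i] :=
    ((1 - q%:R^-1)^-1)%:C *
    cintegral mun sphere (fun u => Dnat abs q mu n.-1 (fun t' => Gamma t' x u) t) in
  let F2 (t : K) (x : 'rV[K]_n) : R[i] :=
    ((1 - q%:R^-1)^-1)%:C * cintegral mun sphere (fun u => Gamma t x u) in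
  (forall F, F = F1 \/ F = F2 ->
     [/\ radial_in_t abs F,
         locally_constant q (@norm_tx R K abs n) (fun p => F p.1 p.2),
         bounded_cfun (fun p : K * 'rV[K]_n => F p.1 p.2) &
         wave_equation abs q mu mun alpha F]) /\
  (forall x, F1 0 x = phi x) /\
  (forall x, Dnat abs q mu n.-1 (fun t => F2 t x) 0 = phi x).
Proof.
case: n hn mun hmun omega homega phi hphi => [//|p] _ mun hmun omega homega phi hphi.
move=> Gamma sphere F1 F2.
have [k [N [kN phik phiN]]] := test_level habs hmu hmun hphi.
have uV := ultraV habs hmu hmun.
have bV := cball_bounded_sat uV 0 kN.
have [s sP] := bounded_sat_net uV bV.
have sN a : a \in s -> normn abs a <= q%:R ^ N.
  by have [_ sD _ _] := sP => /sD; rewrite (BVE habs).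
pose C : R[i] := ((1 - q%:R^-1)^-1)%:C.
pose c a := phi a * ((q%:R ^ k) ^+ p)%:C.
pose e r : R[i] := (ind abs q k r)%:C.
pose E := Dnat abs q mu p e.
have eP : profile abs q k 1 e := ind_profile habs k.
have [ME EPs] := Dnat_profile habs hmu p k 1; have EP := EPs e eP.
have er : radial abs e := ind_radial habs k.
have Er : radial abs E := Dnat_radial habs hmu p eP er.
(* Both definitions of the Radon transform lead to the same family. *)
have GE t x u : normn abs u = 1 -> Gamma t x u = family s c e u (t + dot u x).
  move=> u1; rewrite /Gamma /radon; case: ifP => p1.
    exact: (fourier_radon habs hmu hmun hchi kN phik phiN sP).
  have p2 : (2 <= p.+1)%N by case: (p) p1.
  exact: (hyperplane_radon habs hmu hmun (homega p2) hphi kN phik phiN sP).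
pose c' a := C * c a.
have F2E : F2 = superpose abs mun (family s c' e).
  apply/funext => t; apply/funext => x.
  rewrite /F2 -(superpose_scale habs hmu hmun sN c C t x eP); congr (_ * _).
  by apply: eq_cintegral => u; exact: GE.
have F1E : F1 = superpose abs mun (family s c' E).
  apply/funext => t; apply/funext => x.
  rewrite /F1 -(superpose_scale habs hmu hmun sN c C t x EP); congr (_ * _).
  apply: eq_cintegral => u u1; rewrite -(family_Dnat habs hmu s c p u _ _ eP).
  by congr Dnat; apply/funext => t'; exact: GE.
have initial x : F1 0 x = phi x.
  rewrite F1E (superpose_initial habs hmu hmun s c' x EP).
  rewrite [RHS](test_decomp habs hmu hmun kN phik phiN sP); apply: eq_bigr => a _.
  rewrite /c' /c /ball_density; case: ifP => _; last by rewrite !mulr0.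
  have q0 := q_neq0 habs; have q1 : 1 < q%:R :> R by rewrite ltr1n (q_gt1 habs).
  have X0 : q%:R ^ k != 0 :> R by rewrite expfz_neq0.
  rewrite [C * _]mulrCA -mulrA; congr (_ * _).
  rewrite /C -!rmorphM -(rmorph1 (real_complex R)); congr (_%:C).
  rewrite -invr_expz (exprzAC _ p.+1%:Z k) [_ ^ p.+1%:Z]exprS.
  have Z0 : (q%:R ^ k) ^+ p != 0 :> R by rewrite expf_neq0.
  move: (q%:R ^ k) ((q%:R ^ k) ^+ p) X0 Z0 => X Z X0 Z0.
  field; rewrite q0 X0 Z0 /= subr_eq0 gt_eqF//.
split; last first.
  split; first exact: initial.
  move=> x; rewrite -initial F1E F2E.
  have [M' HP] := family_profile s c' eP.
  rewrite (superpose_Dnat habs hmu hmun HP (family_level habs sN c' eP)).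
  apply: eq_cintegral => u _; exact (family_Dnat habs hmu s c' p u _ _ eP).
have main f M : profile abs q k M f -> radial abs f ->
    let F := superpose abs mun (family s c' f) in
    [/\ radial_in_t abs F,
         locally_constant q (@norm_tx R K abs p.+1) (fun p => F p.1 p.2),
         bounded_cfun (fun p : K * 'rV[K]_p.+1 => F p.1 p.2) &
         wave_equation abs q mu mun alpha F].
  move=> fP fr F; have [M' HP] := family_profile s c' fP.
  have Hu := family_level habs sN c' fP.
  have Hr := family_radial s c' fr.
  split.
  - by move=> w t x w1; exact: (superpose_radial habs hmu hmun HP Hu Hr).
  - exists (- k) => -[t x] [t' x'] /=; rewrite opprK /norm_tx ge_max => /andP[tk xk].
    exact: (superpose_lc habs mun HP).
  - by exists M' => -[t x]; exact: (superpose_bound habs hmu hmun HP Hu).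
  - move=> t x; rewrite /F (superpose_wave habs hmu hmun HP Hu t x halpha).
    exact: subrr.
by move=> F [->|->]; rewrite ?F1E ?F2E; [exact: main EP Er | exact: main eP er].
Qed.
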